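(* There is an (essentially unique) faithful representation $$\tilde{\mathscr A}^{(1)}(\mathbf q):\tilde{\mathcal H}^{(1)}(\mathbf q)\longrightarrow \operatorname{End}_{Z(\tilde{\mathcal H}^{(1)}(\mathbf q))}(\tilde{\mathcal A}^{(1)}(\mathbf q))$$ such that (i) the restriction of $\tilde{\mathscr A}^{(1)}(\mathbf q)$ to $\tilde{\mathcal A}^{(1)}(\mathbf q)$ is the natural inclusion $\tilde{\mathcal A}^{(1)}(\mathbf q)\subset\operatorname{End}_{Z(\tilde{\mathcal H}^{(1)}(\mathbf q))}(\tilde{\mathcal A}^{(1)}(\mathbf q))$ (an element $a$ acts by multiplication $b\mapsto ab$); (ii) $\tilde{\mathscr A}^{(1)}(\mathbf q)(T_s)$ is the Demazure–Vignéras operator on $\tilde{\mathcal A}^{(1)}(\mathbf q)$. Restricting the representation $\tilde{\mathscr A}^{(1)}(\mathbf q)$ to the Iwahori component, its base change $\mathbb Z[\mathbf q]\to\mathbb Z[\mathbf q^{\pm 1/2}]$ coincides with the classical spherical representation of Kazhdan–Lusztig and Ginzburg.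
   Context: Let $q$ be a power of a prime, $\mathbf q$ an indeterminate, $\mathbb T=\mathbb F_q^\times\times\mathbb F_q^\times$, $\Lambda=\mathbb Z\times\mathbb Z$, $W_0=\{1,s\}$ acting on $\mathbb T$ and $\Lambda$ by exchanging the coordinates, $\tilde{\mathbb Z}=\mathbb Z[\frac1{q-1},\mu_{q-1}]$. A tilde denotes base change from $\mathbb Z$ to $\tilde{\mathbb Z}$, and $Z(\cdot)$ denotes the center. The algebra. The generic pro-$p$ Iwahori–Hecke algebra $\mathcal H^{(1)}(\mathbf q)$ of $GL_2$ is the $\mathbb Z[\mathbf q]$-algebra generated by $T_t$ ($t\in\mathbb T$), $S$, $U^{\pm1}$ with relations $T_tT_{t'}=T_{tt'}$, $T_1=1$, $ST_t=T_{s(t)}S$, $UT_t=T_{s(t)}U$, $U^2S=SU^2$, $S^2=\mathbf q+c_sS$, where $c_s=\sum_{a\in\mathbb F_q^\times}T_{(a,a^{-1})}$. It is free over $\mathbb Z[\mathbf q]$ on a basis $T_w$, $w\in W^{(1)}=(\mathbb T\times\Lambda)\rtimes W_0$, with $S=T_s$ and $U=T_u$, $u=(1,0)s$. Put $X=U(S-c_s)$, $Y=SU$, $z_2=U^2$. $\mathcal A^{(1)}(\mathbf q)\subset\mathcal H^{(1)}(\mathbf q)$ is the commutative $\mathbb Z[\mathbf q]$-subalgebra generated by the $T_t$, $X$, $Y$, $z_2^{\pm1}$; it equals $\mathbb Z[\mathbb T]\otimes_{\mathbb Z}\mathbb Z[\mathbf q][z_2^{\pm1}][X,Y]/(XY-\mathbf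 qz_2)$. $W_0$ acts on it by $T_t\mapsto T_{s(t)}$, $X\leftrightarrow Y$, $z_2\mapsto z_2$, and its ring of invariants is $Z(\mathcal H^{(1)}(\mathbf q))$; the same holds over $\tilde{\mathbb Z}$. Components. $\mathbb T^\vee$ is the group of characters $\mathbb T\to\mu_{q-1}\subset\tilde{\mathbb Z}$ with its induced $W_0$-action. For $\lambda\in\mathbb T^\vee$ put $\varepsilon_\lambda=|\mathbb T|^{-1}\sum_{t}\lambda^{-1}(t)T_t$, and for $\gamma\in\mathbb T^\vee/W_0$ put $\varepsilon_\gamma=\sum_{\lambda\in\gamma}\varepsilon_\lambda$. The $\varepsilon_\gamma$ are orthogonal central idempotents with sum $1$, and $\tilde{\mathcal H}^{(1)}(\mathbf q)=\prod_\gamma\tilde{\mathcal H}^\gamma(\mathbf q)$, $\tilde{\mathcal A}^{(1)}(\mathbf q)=\prod_\gamma\tilde{\mathcal A}^\gamma(\mathbf q)$, where the $\gamma$-components are obtained by multiplying with $\varepsilon_\gamma$. An orbit $\gamma$ is regular if $|\gamma|=2$, non-regular if $|\gamma|=1$. An order is chosen on each regular orbit; ''essentially unique'' refers to this choice: the representation depends on it, and once it is fixed the representation is the unique algebra homomorphism satisfying (i) and (ii). The Demazure–Vignéras operator on $\tilde{\mathcal A}^{(1)}(\mathbf q)$ is the product over $\gamma$ of the following operators on $\tilde{\mathcal A}^\gamma(\mathbf q)$ (writing $X,Y,z_2$ for their images in the component). - $\gamma$ regular, with chosen order $(\lambda,\mu)$; write $\varepsilon_1=\varepsilon_\lambda$,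 $\varepsilon_2=\varepsilon_\mu$. Then $\tilde{\mathcal A}^\gamma(\mathbf q)$ is free over its $W_0$-invariants (the center of $\tilde{\mathcal H}^\gamma(\mathbf q)$) with basis $\varepsilon_1,\varepsilon_2$, and the operator is the Vignéras operator $V_s(\mathbf q)$, linear over the invariants, with $V_s(\mathbf q)(\varepsilon_1)=z_2^{-1}(X\varepsilon_1+Y\varepsilon_2)\cdot\varepsilon_2$ and $V_s(\mathbf q)(\varepsilon_2)=(Y\varepsilon_1+X\varepsilon_2)\cdot\varepsilon_1$. - $\gamma$ non-regular. Then $A:=\tilde{\mathcal A}^\gamma(\mathbf q)=\tilde{\mathbb Z}[\mathbf q][z_2^{\pm1}][X,Y]/(XY-\mathbf qz_2)$, with invariants $A^s=\tilde{\mathbb Z}[\mathbf q][X+Y,z_2^{\pm1}]$ (the center of $\tilde{\mathcal H}^\gamma(\mathbf q)$), and $A=A^s\oplus A^sY=A^sX\oplus A^s$. Let $D_s$ be the projector on $A^sY$ along $A^s$, $D_s'$ the projector on $A^s$ along $A^sX$, and $D_s(\mathbf q)=D_s-\mathbf qD_s'$. The operator is $-D_s(\mathbf q)$. Iwahori component. This is the component of the trivial orbit $\gamma=\{1\}$. Its model over $\mathbb Z$ is the generic Iwahori–Hecke algebra $\mathcal H_1(\mathbf q)$, the $\mathbb Z[\mathbf q]$-algebra generated by $S,U^{\pm1}$ with $S^2=\mathbf q+(\mathbf q-1)S$, $U^2S=SU^2$, identified through $S\otimes1\mapsto S\varepsilon_\gamma$, $U\otimes1\mapsto U\varepsilon_\gamma$;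 the model of $\tilde{\mathcal A}^\gamma(\mathbf q)$ is the commutative subalgebra $\mathcal A_1(\mathbf q)\subset\mathcal H_1(\mathbf q)$ generated by $X=U(S-(\mathbf q-1))$, $Y=SU$, $z_2^{\pm1}=U^{\pm2}$, and that of the operator is $-D_s(\mathbf q)$, defined on $\mathcal A_1(\mathbf q)$ by the same formulas. Classical objects. Call $\lambda=(n_1,n_2)\in\Lambda$ antidominant if $n_1\le n_2$; put $\ell(\lambda)=|n_1-n_2|$ and, for $\lambda$ antidominant, $T_{\lambda}:=(SU)^{n_2-n_1}U^{2n_1}\in\mathcal H_1(\mathbf q)$. For $\lambda=\lambda_1-\lambda_2$ with $\lambda_1,\lambda_2$ antidominant, $\tilde\theta_\lambda:=\mathbf q^{-\ell(\lambda_1)/2}\mathbf q^{\ell(\lambda_2)/2}T_{\lambda_1}T_{\lambda_2}^{-1}$. The Bernstein isomorphism $\tilde\theta:\mathbb Z[\mathbf q^{\pm1/2}][\Lambda]\to\mathbb Z[\mathbf q^{\pm1/2}]\otimes_{\mathbb Z[\mathbf q]}\mathcal A_1(\mathbf q)$, $e^\lambda\mapsto\tilde\theta_\lambda$, is used to transport the base-changed representation to $\mathbb Z[\mathbf q^{\pm1/2}][\Lambda]$. The classical spherical representation (for the antidominant orientation) is the algebra homomorphism $\mathbb Z[\mathbf q^{\pm1/2}]\otimes_{\mathbb Z[\mathbf q]}\mathcal H_1(\mathbf q)\to\operatorname{End}_{\mathbb Z[\mathbf q^{\pm1/2}][\Lambda]^{W_0}}(\mathbb Z[\mathbf q^{\pm1/2}][\Lambda])$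 which sends $\tilde\theta_\lambda$ to multiplication by $e^\lambda$ and $S$ to the operator $$e^\lambda\longmapsto\frac{e^\lambda-e^{s(\lambda)}}{e^\alpha-1}-\mathbf q\,\frac{e^\lambda-e^{s(\lambda)+\alpha}}{e^\alpha-1},\qquad\alpha=(1,-1).$$
   Formalization: c_s is multiplied by (𝐪−1)/(q−1), so the algebra is defined over Z̃[𝐪]. With the literal c_s, (ii) on the trivial component gives 𝐪² = 𝐪 + (q−1)𝐪, false for the indeterminate 𝐪; regular components are unchanged. *)

(* Defs.v *)
From HB Require Import structures.
From mathcomp Require Import all_boot all_order all_algebra all_fingroup all_field.
From mathcomp Require Import boolp.

Set Implicit Arguments.
Unset Strict Implicit.
Unset Printing Implicit Defensive.

Import GRing.Theory Num.Theory.
Local Open Scope ring_scope.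

Inductive expr (K I : Type) : Type :=
| Cst of K
| Gen of I
| Add of expr K I & expr K I
| Mul of expr K I & expr K I.
Arguments Cst {K I}.
Arguments Gen {K I}.

(* The congruence generated by rel and the axioms of K-algebras; it is the
   equality of the algebra K<I | rel>. *)
Inductive algeq (K : comNzRingType) (I : Type)
    (rel : expr K I -> expr K I -> Prop) : expr K I -> expr K I -> Prop :=
| algeq_rel x y : rel x y -> algeq rel x y
| algeq_refl x : algeq rel x x
| algeq_sym x y : algeq rel x y -> algeq rel y x
| algeq_trans x y z : algeq rel x y -> algeq rel y z -> algeq rel x z
| algeq_add x x' y y' :
    algeq rel x x' -> algeq rel y y' -> algeq rel (Add x y) (Add x' y')
| algeq_mul x x' y y' :
    algeq rel x x' -> algeq rel y y' -> algeq rel (Mul x y) (Mul x' y')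
| algeq_addA x y z : algeq rel (Add x (Add y z)) (Add (Add x y) z)
| algeq_addC x y : algeq rel (Add x y) (Add y x)
| algeq_add0 x : algeq rel (Add (Cst 0) x) x
| algeq_mulA x y z : algeq rel (Mul x (Mul y z)) (Mul (Mul x y) z)
| algeq_mul1 x : algeq rel (Mul (Cst 1) x) x
| algeq_mul0 x : algeq rel (Mul (Cst 0) x) (Cst 0)
| algeq_mulDl x y z : algeq rel (Mul (Add x y) z) (Add (Mul x z) (Mul y z))
| algeq_mulDr x y z : algeq rel (Mul z (Add x y)) (Add (Mul z x) (Mul z y))
| algeq_cstD a b : algeq rel (Add (Cst a) (Cst b)) (Cst (a + b))
| algeq_cstM a b : algeq rel (Mul (Cst a) (Cst b)) (Cst (a * b))
| algeq_cstC a x : algeq rel (Mul (Cst a) x) (Mul x (Cst a)).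

HB.instance Definition _ (K I : Type) := gen_eqMixin (expr K I).
HB.instance Definition _ (K I : Type) := gen_choiceMixin (expr K I).

(* MathComp algebras are nonzero, hence the field presP. *)
Record presentation (K : comNzRingType) (I : Type) := Presentation {
  pres_rel : expr K I -> expr K I -> Prop;
  presP : ~ algeq pres_rel (Cst 1) (Cst 0)
}.

Section Eval.
Variables (K L : comNzRingType) (phi : {rmorphism K -> L}) (I : Type).
Variable g : I -> L.

Fixpoint eval (x : expr K I) : L :=
  match x with
  | Cst a => phi a
  | Gen i => g i
  | Add x y => eval x + eval y
  | Mul x y => eval x * eval y
  end.

Lemma eval_algeq (rel : expr K I -> expr K I -> Prop) :
  (forall x y, rel x y -> eval x = eval y) ->
  forall x y, algeq rel x y -> eval x = eval y.
Proof.
move=> relP x y; elim=> //=.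
- by move=> ? ? ? _ -> _ ->.
- by move=> ? ? ? ? _ -> _ ->.
- by move=> ? ? ? ? _ -> _ ->.
- by move=> *; rewrite addrA.
- by move=> *; rewrite addrC.
- by move=> *; rewrite rmorph0 add0r.
- by move=> *; rewrite mulrA.
- by move=> *; rewrite rmorph1 mul1r.
- by move=> *; rewrite rmorph0 mul0r.
- by move=> *; rewrite mulrDl.
- by move=> *; rewrite mulrDr.
- by move=> *; rewrite rmorphD.
- by move=> *; rewrite rmorphM.
- by move=> *; rewrite mulrC.
Qed.

Lemma eval_consistent (rel : expr K I -> expr K I -> Prop) :
  (forall x y, rel x y -> eval x = eval y) -> ~ algeq rel (Cst 1) (Cst 0).
Proof.
move=> relP /(eval_algeq relP) /=; rewrite rmorph1 rmorph0 => /eqP.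
by rewrite oner_eq0.
Qed.

End Eval.

Section PresentedAlgebra.
Variables (K : comNzRingType) (I : Type) (P : presentation K I).
Local Open Scope quotient_scope.
Local Notation E := (expr K I).
Local Notation "x ~~~ y" := (algeq (pres_rel P) x y) (at level 70).

Definition algeqb (x y : E) : bool := `[< x ~~~ y >].

Lemma algeqb_equiv : equiv_class_of algeqb.
Proof.
split=> [x|x y|y x z].
- exact/asboolP/algeq_refl.
- by apply/asboolP/asboolP => /algeq_sym.
- by move=> /asboolP xy /asboolP yz; apply/asboolP/(algeq_trans xy yz).
Qed.

Canonical algeqb_equiv_rel := EquivRelPack algeqb_equiv.
Canonical algeqb_encModRel := defaultEncModRel algeqb.

Definition presAlg := {eq_quot algeqb}.

HB.instance Definition _ : EqQuotient E algeqb presAlg := EqQuotient.on presAlg.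
HB.instance Definition _ := Choice.on presAlg.

Definition pres_class (x : E) : presAlg := \pi_presAlg x.

Lemma pres_classP x y : pres_class x = pres_class y <-> x ~~~ y.
Proof.
split=> [/eqmodP /asboolP //|xy]; exact/eqmodP/asboolP.
Qed.

Definition pres_repr (x : presAlg) : E := generic_quotient.repr x.

Lemma pres_reprK x : pres_class (pres_repr x) = x.
Proof. exact: reprK. Qed.

Lemma pres_repr_class x : pres_repr (pres_class x) ~~~ x.
Proof. by apply/pres_classP; rewrite pres_reprK. Qed.

Definition pres_add (x y : presAlg) := pres_class (Add (pres_repr x) (pres_repr y)).
Definition pres_mul (x y : presAlg) := pres_class (Mul (pres_repr x) (pres_repr y)).
Definition pres_scale (a : K) (x : presAlg) := pres_class (Mul (Cst a) (pres_repr x)).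

Lemma pres_addE x y : pres_add (pres_class x) (pres_class y) = pres_class (Add x y).
Proof. by apply/pres_classP/algeq_add; apply: pres_repr_class. Qed.

Lemma pres_mulE x y : pres_mul (pres_class x) (pres_class y) = pres_class (Mul x y).
Proof. by apply/pres_classP/algeq_mul; apply: pres_repr_class. Qed.

Lemma pres_scaleE a x : pres_scale a (pres_class x) = pres_class (Mul (Cst a) x).
Proof.
by apply/pres_classP/algeq_mul; [apply: algeq_refl | apply: pres_repr_class].
Qed.

Lemma pres_ind (Q : presAlg -> Prop) :
  (forall x, Q (pres_class x)) -> forall x, Q x.
Proof. by move=> QP x; rewrite -(pres_reprK x). Qed.

Fact pres_addA : associative pres_add.
Proof.
elim/pres_ind=> x; elim/pres_ind=> y; elim/pres_ind=> z; rewrite !pres_addE.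
exact/pres_classP/algeq_addA.
Qed.

Fact pres_addC : commutative pres_add.
Proof.
elim/pres_ind=> x; elim/pres_ind=> y; rewrite !pres_addE.
exact/pres_classP/algeq_addC.
Qed.

Fact pres_add0 : left_id (pres_class (Cst 0)) pres_add.
Proof.
by elim/pres_ind=> x; rewrite pres_addE; apply/pres_classP/algeq_add0.
Qed.

Fact pres_addN : left_inverse (pres_class (Cst 0)) (pres_scale (- 1)) pres_add.
Proof.
elim/pres_ind=> x; rewrite pres_scaleE pres_addE; apply/pres_classP.
apply: algeq_trans (_ : Mul (Cst (- 1 + 1)) x ~~~ _); last first.
  by rewrite addNr; apply: algeq_mul0.
apply: algeq_trans (algeq_mul (algeq_cstD _ _ _) (algeq_refl _ _)).
apply: algeq_trans (algeq_sym (algeq_mulDl _ _ _ _)).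
apply: algeq_add; first exact: algeq_refl.
exact/algeq_sym/algeq_mul1.
Qed.

HB.instance Definition _ :=
  GRing.isZmodule.Build presAlg pres_addA pres_addC pres_add0 pres_addN.

Fact pres_mulA : associative pres_mul.
Proof.
elim/pres_ind=> x; elim/pres_ind=> y; elim/pres_ind=> z; rewrite !pres_mulE.
exact/pres_classP/algeq_mulA.
Qed.

Fact pres_mul1 : left_id (pres_class (Cst 1)) pres_mul.
Proof.
by elim/pres_ind=> x; rewrite pres_mulE; apply/pres_classP/algeq_mul1.
Qed.

Fact pres_1mul : right_id (pres_class (Cst 1)) pres_mul.
Proof.
elim/pres_ind=> x; rewrite pres_mulE; apply/pres_classP.
exact: algeq_trans (algeq_sym (algeq_cstC _ _ _)) (algeq_mul1 _ _).
Qed.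

Fact pres_mulDl : left_distributive pres_mul +%R.
Proof.
elim/pres_ind=> x; elim/pres_ind=> y; elim/pres_ind=> z.
rewrite {1}[_ + _]pres_addE !pres_mulE [RHS]pres_addE.
exact/pres_classP/algeq_mulDl.
Qed.

Fact pres_mulDr : right_distributive pres_mul +%R.
Proof.
elim/pres_ind=> x; elim/pres_ind=> y; elim/pres_ind=> z.
rewrite {1}[_ + _]pres_addE !pres_mulE [RHS]pres_addE.
exact/pres_classP/algeq_mulDr.
Qed.

Fact pres_oner_neq0 : pres_class (Cst 1) != 0.
Proof. by apply/eqP => /pres_classP; apply: presP. Qed.

HB.instance Definition _ := GRing.Zmodule_isNzRing.Build presAlg
  pres_mulA pres_mul1 pres_1mul pres_mulDl pres_mulDr pres_oner_neq0.

Fact pres_scaleA a b x : pres_scale a (pres_scale b x) = pres_scale (a * b) x.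
Proof.
elim/pres_ind: x => x; rewrite !pres_scaleE; apply/pres_classP.
apply: algeq_trans (algeq_mulA _ _ _ _) _.
exact: algeq_mul (algeq_cstM _ _ _) (algeq_refl _ _).
Qed.

Fact pres_scale1 : left_id 1 pres_scale.
Proof.
by elim/pres_ind=> x; rewrite pres_scaleE; apply/pres_classP/algeq_mul1.
Qed.

Fact pres_scaleDr : right_distributive pres_scale +%R.
Proof.
move=> a; elim/pres_ind=> x; elim/pres_ind=> y.
rewrite {1}[_ + _]pres_addE !pres_scaleE [RHS]pres_addE.
exact/pres_classP/algeq_mulDr.
Qed.

Fact pres_scaleDl x : {morph pres_scale^~ x : a b / a + b}.
Proof.
move=> a b /=; elim/pres_ind: x => x; rewrite !pres_scaleE [RHS]pres_addE.
apply/pres_classP; apply: algeq_trans (algeq_mulDl _ _ _ _).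
exact: algeq_mul (algeq_sym (algeq_cstD _ _ _)) (algeq_refl _ _).
Qed.

HB.instance Definition _ := GRing.Zmodule_isLmodule.Build K presAlg
  pres_scaleA pres_scale1 pres_scaleDr pres_scaleDl.

Fact pres_scaleAl (a : K) (x y : presAlg) : a *: (x * y) = (a *: x) * y.
Proof.
elim/pres_ind: x => x; elim/pres_ind: y => y.
rewrite {1}[_ * _]pres_mulE {1}[_ *: _]pres_scaleE.
rewrite {1}[_ *: _]pres_scaleE [RHS]pres_mulE.
exact/pres_classP/algeq_mulA.
Qed.

HB.instance Definition _ := GRing.Lmodule_isLalgebra.Build K presAlg pres_scaleAl.

Fact pres_scaleAr (a : K) (x y : presAlg) : a *: (x * y) = x * (a *: y).
Proof.
elim/pres_ind: x => x; elim/pres_ind: y => y.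
rewrite {1}[_ * _]pres_mulE {1}[_ *: _]pres_scaleE.
rewrite {1}[_ *: _]pres_scaleE [RHS]pres_mulE; apply/pres_classP.
apply: algeq_trans (algeq_mulA _ _ _ _) _.
apply: algeq_trans (algeq_mul (algeq_cstC _ _ _) (algeq_refl _ _)) _.
exact/algeq_sym/algeq_mulA.
Qed.

HB.instance Definition _ := GRing.Lalgebra_isAlgebra.Build K presAlg pres_scaleAr.

Lemma pres_classD x y : pres_class (Add x y) = pres_class x + pres_class y.
Proof. exact/esym/pres_addE. Qed.

Lemma pres_classM x y : pres_class (Mul x y) = pres_class x * pres_class y.
Proof. exact/esym/pres_mulE. Qed.

Definition pgen (i : I) : presAlg := pres_class (Gen i).

End PresentedAlgebra.

Section GeneratedSubalgebra.
Variables (K : comNzRingType) (H : algType K) (G : H -> Prop).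

Inductive in_subalg : H -> Prop :=
| in_subalg_gen x : G x -> in_subalg x
| in_subalg_one : in_subalg 1
| in_subalg_add x y : in_subalg x -> in_subalg y -> in_subalg (x + y)
| in_subalg_mul x y : in_subalg x -> in_subalg y -> in_subalg (x * y)
| in_subalg_scale a x : in_subalg x -> in_subalg (a *: x).

Definition subalg_pred : {pred H} := fun x => `[< in_subalg x >].

Fact subalg_closed : GRing.subsemialg_closed subalg_pred.
Proof.
split; first exact/asboolP/in_subalg_one.
- split; last first.
    by move=> x y /asboolP ? /asboolP ?; apply/asboolP/in_subalg_add.
  apply/asboolP; rewrite -(scale0r (1 : H)).
  exact/in_subalg_scale/in_subalg_one.
- by move=> a x /asboolP ?; apply/asboolP/in_subalg_scale.
- by move=> x y /asboolP ? /asboolP ?; apply/asboolP/in_subalg_mul.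
Qed.

Definition subalg := {x : H | subalg_pred x}.
HB.instance Definition _ := SubChoice.on subalg.
HB.instance Definition _ :=
  GRing.SubChoice_isSubAlgebra.Build K H subalg_pred subalg subalg_closed.

Definition subalg_of (x : H) (Gx : G x) : subalg :=
  exist _ x (introT (asboolP _) (in_subalg_gen Gx)).

End GeneratedSubalgebra.

(* The group ring R[G], as the R-algebra generated by the symbols e^g with the
   relations e^0 = 1 and e^g e^h = e^(g + h). *)
Section GroupRing.
Variables (R : comNzRingType) (G : zmodType).

Inductive group_rel : expr R G -> expr R G -> Prop :=
| group_rel0 : group_rel (Gen 0) (Cst 1)
| group_relD g h : group_rel (Mul (Gen g) (Gen h)) (Gen (g + h)).

Fact group_relP : ~ algeq group_rel (Cst 1) (Cst 0).
Proof.
apply: (@eval_consistent R R idfun G (fun=> 1)) => x y.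
by case=> //= *; rewrite mulr1.
Qed.

Definition group_pres := Presentation group_relP.
Definition groupRing := presAlg group_pres.
HB.instance Definition _ := GRing.Algebra.on groupRing.

Definition gexp (g : G) : groupRing := pgen group_pres g.

Lemma gexpD g h : gexp (g + h) = gexp g * gexp h.
Proof.
rewrite [RHS]pres_mulE; apply/esym/pres_classP.
exact: (@algeq_rel _ _ group_rel _ _ (group_relD g h)).
Qed.

Fact groupRing_mulC : commutative (@GRing.mul groupRing).
Proof.
have cstC a (y : groupRing) : pres_class group_pres (Cst a) * y
    = y * pres_class group_pres (Cst a).
  elim/pres_ind: y => y; rewrite -!pres_classM.
  exact/pres_classP/algeq_cstC.
move=> x; elim/pres_ind: x => x.
elim: x => [a|g|x IHx z IHz|x IHx z IHz] y; first exact: cstC.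
- elim/pres_ind: y => y; elim: y => [a|h|y IHy z IHz|y IHy z IHz].
  + exact/esym/cstC.
  + by rewrite -!/(gexp _) -!gexpD addrC.
  + by rewrite pres_classD mulrDl mulrDr IHy IHz.
  + by rewrite pres_classM mulrA IHy -!mulrA IHz.
- by rewrite pres_classD mulrDl mulrDr IHx IHz.
- by rewrite pres_classM -mulrA IHz mulrA IHx -mulrA.
Qed.

HB.instance Definition _ :=
  GRing.PzRing_hasCommutativeMul.Build groupRing groupRing_mulC.

End GroupRing.

(* Z[1/(q-1), mu_(q-1)] for q = #|F|, inside algC. *)
Section Coefficients.
Variable F : finFieldType.
Local Notation qm1 := (#|F|.-1).

Inductive in_Zt : algC -> Prop :=
| in_Zt_inv : in_Zt (qm1%:R^-1)
| in_Zt_root z : z ^+ qm1 = 1 -> in_Zt z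
| in_Zt_sub x y : in_Zt x -> in_Zt y -> in_Zt (x - y)
| in_Zt_mul x y : in_Zt x -> in_Zt y -> in_Zt (x * y).

Definition Zt_pred : {pred algC} := fun x => `[< in_Zt x >].

Fact Zt_closed : GRing.subring_closed Zt_pred.
Proof.
split; first by apply/asboolP/in_Zt_root; rewrite expr1n.
  by move=> x y /asboolP ? /asboolP ?; apply/asboolP/in_Zt_sub.
by move=> x y /asboolP ? /asboolP ?; apply/asboolP/in_Zt_mul.
Qed.

Definition Zt := {x : algC | Zt_pred x}.
HB.instance Definition _ := SubChoice.on Zt.
HB.instance Definition _ :=
  GRing.SubChoice_isSubComNzRing.Build algC Zt_pred Zt Zt_closed.

Definition inv_qm1 : Zt := exist _ (qm1%:R^-1) (introT (asboolP _) in_Zt_inv).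

End Coefficients.

(* A K-algebra with the distinguished elements from which X, Y, z_2 and the
   commutative subalgebra are built; hV is the inverse of hU, and hswap is the
   action of s on the index set of the T_t. *)
Record heckeData (K : comNzRingType) := HeckeData {
  halg :> algType K;
  hidx : Type;
  hswap : hidx -> hidx;
  hT : hidx -> halg;
  hS : halg;
  hU : halg;
  hV : halg;
  hc : halg
}.

Section ProPIwahori.
Variable F : finFieldType.

Definition torus := ({unit F} * {unit F})%type.
Definition tswap (t : torus) : torus := (t.2, t.1).

Inductive hecke_gen := GT of torus | GS | GU | GV.

Local Notation K := {poly Zt F}.
Local Notation E := (expr K hecke_gen).
Local Notation "x '*e' y" := (Mul x y) (at level 40, left associativity).
Local Notation "x '+e' y" := (Add x y) (at level 50, left associativity).

(* The indeterminate bold q is 'X, and q = #|F|.  The usual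
   c_s = \sum_a T_(a, 1/a) acts on the component of a non-regular orbit as the
   integer q - 1, which is incompatible there with the quadratic relation
   S^2 = bold q + (bold q - 1) S of the generic Iwahori-Hecke algebra; it is
   therefore multiplied by (bold q - 1)/(q - 1).  The factor is 1 at bold q = q,
   and immaterial on the components of the regular orbits, where c_s is 0. *)
Definition cs_coef : K := (inv_qm1 F)%:P * ('X - 1).
Definition cs_expr : E :=
  Cst cs_coef *e
  \big[@Add K hecke_gen/Cst 0]_(a : {unit F}) Gen (GT ((a, a^-1)%g : torus)).

Inductive hecke_rel : E -> E -> Prop :=
| hecke_TT (t u : torus) :
    hecke_rel (Gen (GT t) *e Gen (GT u)) (Gen (GT (t * u)%g))
| hecke_T1 : hecke_rel (Gen (GT (1%g : torus))) (Cst 1)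
| hecke_ST t : hecke_rel (Gen GS *e Gen (GT t)) (Gen (GT (tswap t)) *e Gen GS)
| hecke_UT t : hecke_rel (Gen GU *e Gen (GT t)) (Gen (GT (tswap t)) *e Gen GU)
| hecke_UV : hecke_rel (Gen GU *e Gen GV) (Cst 1)
| hecke_VU : hecke_rel (Gen GV *e Gen GU) (Cst 1)
| hecke_UUS :
    hecke_rel (Gen GU *e Gen GU *e Gen GS) (Gen GS *e (Gen GU *e Gen GU))
| hecke_SS : hecke_rel (Gen GS *e Gen GS) (Cst 'X +e cs_expr *e Gen GS).

Fact hecke_relP : ~ algeq hecke_rel (Cst 1) (Cst 0).
Proof.
pose g x : K := if x is GS then 'X else 1.
apply: (@eval_consistent K K idfun _ g) => x y.
case=> //= *; rewrite ?mulr1 ?mul1r //.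
rewrite (big_morph (eval idfun g) (op1 := +%R) (id1 := 0)) //=.
rewrite sumr_const -cardsT card_finField_unit /cs_coef.
suff ->: (inv_qm1 F)%:P * ('X - 1) * (#|F|.-1)%:R = 'X - 1 :> K.
  by rewrite mulrBl mul1r addrCA subrr addr0.
rewrite mulrAC -[X in _ * X * _]polyC_natr -polyCM.
suff ->: inv_qm1 F * (#|F|.-1)%:R = 1 by rewrite mul1r.
apply: val_inj; rewrite rmorphM rmorph_nat rmorph1 /= mulVf //.
rewrite pnatr_eq0 -lt0n -ltnS prednK; first exact: finNzRing_gt1.
exact: ltnW (finNzRing_gt1 F).
Qed.

Definition hecke_pres := Presentation hecke_relP.
Definition hecke_alg := presAlg hecke_pres.
HB.instance Definition _ := GRing.Algebra.on hecke_alg.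

Local Notation gen x := (pgen hecke_pres x : hecke_alg).

Definition hecke : heckeData K :=
  @HeckeData K hecke_alg torus tswap (fun t => gen (GT t)) (gen GS) (gen GU)
    (gen GV) (pres_class hecke_pres cs_expr).

End ProPIwahori.

Section Iwahori.
Variables (K : comNzRingType) (qq : K).

Inductive iwahori_gen := IS | IU | IV.

Local Notation E := (expr K iwahori_gen).
Local Notation "x '*e' y" := (Mul x y) (at level 40, left associativity).
Local Notation "x '+e' y" := (Add x y) (at level 50, left associativity).

Inductive iwahori_rel : E -> E -> Prop :=
| iwahori_UV : iwahori_rel (Gen IU *e Gen IV) (Cst 1)
| iwahori_VU : iwahori_rel (Gen IV *e Gen IU) (Cst 1)
| iwahori_UUS :
    iwahori_rel (Gen IU *e Gen IU *e Gen IS) (Gen IS *e (Gen IU *e Gen IU))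
| iwahori_SS :
    iwahori_rel (Gen IS *e Gen IS) (Cst qq +e Cst (qq - 1) *e Gen IS).

Fact iwahori_relP : ~ algeq iwahori_rel (Cst 1) (Cst 0).
Proof.
apply: (@eval_consistent K K idfun _ (fun x => if x is IS then qq else 1)).
move=> x y; case=> //=; rewrite ?mulr1 ?mul1r //.
by rewrite mulrBl mul1r addrCA subrr addr0.
Qed.

Definition iwahori_pres := Presentation iwahori_relP.
Definition iwahori_alg := presAlg iwahori_pres.
HB.instance Definition _ := GRing.Algebra.on iwahori_alg.

Local Notation gen x := (pgen iwahori_pres x : iwahori_alg).

Definition iwahori : heckeData K :=
  @HeckeData K iwahori_alg void id (of_void _) (gen IS) (gen IU) (gen IV)
    ((qq - 1) *: 1).

End Iwahori.

Section CommutativeSubalgebra.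
Variables (K : comNzRingType) (H : heckeData K).

Definition hX : H := hU H * (hS H - hc H).
Definition hY : H := hS H * hU H.
Definition hz : H := hU H ^+ 2.
Definition hzV : H := hV H ^+ 2.

Inductive A_gen : H -> Prop :=
| A_gen_T i : A_gen (hT i)
| A_gen_X : A_gen hX
| A_gen_Y : A_gen hY
| A_gen_z : A_gen hz
| A_gen_zV : A_gen hzV.

Local Notation Asub := (subalg A_gen).

Definition aT i : Asub := subalg_of (A_gen_T i).
Definition aX : Asub := subalg_of A_gen_X.
Definition aY : Asub := subalg_of A_gen_Y.
Definition az : Asub := subalg_of A_gen_z.
Definition azV : Asub := subalg_of A_gen_zV.

Definition is_swap (f : Asub -> Asub) : Prop :=
  [/\ forall i, f (aT i) = aT (hswap i), f aX = aY, f aY = aX & f az = az].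

Definition W0_invariant (a : Asub) : Prop :=
  exists2 f : {lrmorphism Asub -> Asub}, is_swap f & f a = a.

Section Operators.
Variable qq : K.

Definition is_projector (M N : Asub -> Prop) (D : Asub -> Asub) : Prop :=
  forall m n, M m -> N n -> D (m + n) = m.

(* The invariants of the component cut out by the idempotent e. *)
Definition comp_invariant (e a : Asub) : Prop := W0_invariant a /\ e * a = a.

Definition is_Ds (e : Asub) (D : Asub -> Asub) : Prop :=
  is_projector (fun a => exists2 b, comp_invariant e b & a = b * aY)
               (comp_invariant e) D.

Definition is_Ds' (e : Asub) (D' : Asub -> Asub) : Prop :=
  is_projector (comp_invariant e)
               (fun a => exists2 b, comp_invariant e b & a = b * aX) D'.

(* f is -D_s(qq) on the component cut out by e. *)
Definition demazure_on (e : Asub) (f : Asub -> Asub) : Prop :=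
  exists D D', [/\ is_Ds e D, is_Ds' e D' &
    forall a, e * a = a -> f a = - (D a - qq *: D' a)].

(* f is V_s(qq) on the component cut out by e1 + e2, for the order (e1, e2). *)
Definition vigneras_on (e1 e2 : Asub) (f : Asub -> Asub) : Prop :=
  [/\ forall c a, comp_invariant (e1 + e2) c -> (e1 + e2) * a = a ->
        f (c * a) = c * f a,
      forall a b, (e1 + e2) * a = a -> (e1 + e2) * b = b ->
        f (a + b) = f a + f b,
      f e1 = azV * (aX * e1 + aY * e2) * e2
    & f e2 = (aY * e1 + aX * e2) * e1].

End Operators.

Definition central (z : H) : Prop := forall h : H, z * h = h * z.

Definition center_linear (f : Asub -> Asub) : Prop :=
  (forall a b, f (a + b) = f a + f b) /\
  (forall z, central z ->
     forall a b : Asub, val b = z * val a -> val (f b) = z * val (f a)).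

End CommutativeSubalgebra.

Notation Asub H := (subalg (@A_gen _ H)).

(* rho is a homomorphism of K-algebras from H to the algebra of the
   endomorphisms of M satisfying lin, with pointwise operations. *)
Definition is_rep (K : comNzRingType) (H : algType K) (M : lmodType K)
    (lin : (M -> M) -> Prop) (rho : H -> M -> M) : Prop :=
  [/\ forall h, lin (rho h),
      forall h h' a, rho (h + h') a = rho h a + rho h' a,
      forall h h' a, rho (h * h') a = rho h (rho h' a),
      forall a, rho 1 a = a
    & forall k h a, rho (k *: h) a = k *: rho h a].

Definition faithful_rep (K : comNzRingType) (H : algType K) (M : lmodType K)
    (rho : H -> M -> M) : Prop :=
  forall h h', rho h =1 rho h' -> h = h'.

Section HeckeRepresentation.
Variables (K : comNzRingType) (H : heckeData K).

Definition hecke_rep (rho : H -> Asub H -> Asub H) : Prop :=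
  is_rep (@center_linear K H) rho.

Definition extends_mul (rho : H -> Asub H -> Asub H) : Prop :=
  forall a b : Asub H, rho (val a) b = a * b.

End HeckeRepresentation.

Section Components.
Variable F : finFieldType.
Local Notation K := {poly Zt F}.
Local Notation chi := {ffun torus F -> Zt F}.

Definition is_char (l : chi) : Prop :=
  l 1%g = 1 /\ forall t u, l (t * u)%g = l t * l u.

Definition char_swap (l : chi) : chi := [ffun t => l (tswap t)].

Definition triv_char : chi := [ffun=> 1].

(* The order of the torus is (q - 1)^2. *)
Definition eps (l : chi) : Asub (hecke F) :=
  ((inv_qm1 F) ^+ 2)%:P *: \sum_t (l t^-1%g)%:P *: @aT K (hecke F) t.

(* An order on each regular orbit {l, char_swap l}: the first element is the
   one on which ord holds. *)
Definition orbit_order (ord : pred chi) : Prop :=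
  forall l, is_char l -> char_swap l <> l -> ord (char_swap l) = ~~ ord l.

Definition demazure_vigneras (ord : pred chi)
    (f : Asub (hecke F) -> Asub (hecke F)) : Prop :=
  [/\ forall a b, f (a + b) = f a + f b,
      forall l, is_char l -> char_swap l <> l -> ord l ->
        vigneras_on (eps l) (eps (char_swap l)) f
    & forall l, is_char l -> char_swap l = l -> demazure_on 'X (eps l) f].

End Components.

(* Z[bold q^(1/2), bold q^(-1/2)]; gexp n is the n-th power of bold q^(1/2). *)
Notation Zhalf := (groupRing int int).
Definition vpow (n : int) : Zhalf := gexp int n.

Definition HZ := iwahori ('X : {poly int}).
Definition HZt (F : finFieldType) := iwahori ('X : {poly Zt F}).
Definition Hhalf := iwahori (vpow 2).

Definition polyZ_to_Zt (F : finFieldType) (p : {poly int}) : {poly Zt F} :=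
  map_poly intr p.
Definition polyZ_to_Zhalf (p : {poly int}) : Zhalf :=
  (map_poly intr p).[vpow 2].

(* b is the base change along phi of the Iwahori-Hecke algebra. *)
Definition is_base_change (K K' : comNzRingType) (qq : K) (qq' : K')
    (phi : K -> K') (b : {rmorphism iwahori qq -> iwahori qq'}) : Prop :=
  [/\ forall k h, b (k *: h) = phi k *: b h,
      b (hS (iwahori qq)) = hS (iwahori qq')
    & b (hU (iwahori qq)) = hU (iwahori qq')].

(* i identifies the Iwahori-Hecke algebra with the Iwahori component of the
   pro-p Iwahori-Hecke algebra. *)
Definition is_iwahori_component (F : finFieldType)
    (i : {linear HZt F -> hecke F}) : Prop :=
  let e : hecke F := val (eps (triv_char F)) in
  [/\ forall h h', i (h * h') = i h * i h', i 1 = e,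
      i (hS (HZt F)) = hS (hecke F) * e, i (hU (HZt F)) = hU (hecke F) * e
    & injective i /\ forall h : hecke F, h * e = h -> exists h', i h' = h].

Definition Lambda := (int * int)%type.
Definition lswap (l : Lambda) : Lambda := (l.2, l.1).
Definition alpha : Lambda := (1, -1).
Definition antidominant (l : Lambda) : bool := l.1 <= l.2.
Definition len (l : Lambda) : int := `|l.1 - l.2|.

Notation ZLambda := (groupRing Zhalf Lambda).
Definition e_ (l : Lambda) : ZLambda := gexp Zhalf l.

Definition ZLambda_invariant (f : ZLambda) : Prop :=
  exists2 s : {lrmorphism ZLambda -> ZLambda},
    (forall l, s (e_ l) = e_ (lswap l)) & s f = f.

Definition ZLambda_linear (g : ZLambda -> ZLambda) : Prop :=
  (forall a b, g (a + b) = g a + g b) /\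
  (forall c a, ZLambda_invariant c -> g (c * a) = c * g a).

(* U^(2n), for n in Z. *)
Definition z2pow (K : comNzRingType) (H : heckeData K) (n : int) : H :=
  match n with Posz m => hz H ^+ m | Negz m => hzV H ^+ m.+1 end.

(* T_l, for l antidominant. *)
Definition Tantidom (K : comNzRingType) (H : heckeData K) (l : Lambda) : H :=
  hY H ^+ `|(l.2 - l.1)|%N * z2pow H l.1.

Definition is_bernstein (theta : {lrmorphism ZLambda -> Asub Hhalf}) : Prop :=
  bijective theta /\
  forall l1 l2, antidominant l1 -> antidominant l2 ->
    exists2 w : Hhalf,
      w * Tantidom Hhalf l2 = 1 /\ Tantidom Hhalf l2 * w = 1
    & val (theta (e_ (l1 - l2)))
      = (vpow (- len l1) * vpow (len l2)) *: (Tantidom Hhalf l1 * w).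

(* The quotients by e^alpha - 1 are taken in the ring ZLambda. *)
Definition is_classical_spherical (theta : {lrmorphism ZLambda -> Asub Hhalf})
    (sigma : Hhalf -> ZLambda -> ZLambda) : Prop :=
  [/\ is_rep ZLambda_linear sigma,
      forall l f, sigma (val (theta (e_ l))) f = e_ l * f
    & forall l, exists d d' : ZLambda,
        [/\ d * (e_ alpha - 1) = e_ l - e_ (lswap l),
            d' * (e_ alpha - 1) = e_ l - e_ (lswap l + alpha)
          & sigma (hS Hhalf) (e_ l) = d - vpow 2 *: d']].

(* The restriction of rho to the Iwahori component comes from a representation
   rho1 over Z[bold q], whose base change to Z[bold q^(1/2), bold q^(-1/2)],
   transported by the Bernstein isomorphism, is the classical spherical
   representation. *)
Definition iwahori_component_spherical (F : finFieldType)
    (rho : hecke F -> Asub (hecke F) -> Asub (hecke F)) : Prop :=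
  exists (b : {rmorphism HZ -> HZt F}) (i : {linear HZt F -> hecke F})
         (rho1 : HZ -> Asub HZ -> Asub HZ)
         (b' : {rmorphism HZ -> Hhalf})
         (rho' : Hhalf -> Asub Hhalf -> Asub Hhalf)
         (theta : {lrmorphism ZLambda -> Asub Hhalf})
         (sigma : Hhalf -> ZLambda -> ZLambda),
  [/\ [/\ is_base_change (@polyZ_to_Zt F) b, is_iwahori_component i
        & [/\ hecke_rep rho1, extends_mul rho1
            & demazure_on 'X 1 (rho1 (hS HZ))]],
      (forall h (a : Asub HZ), exists2 a' : Asub (hecke F),
         val a' = i (b (val a))
         & val (rho (i (b h)) a') = i (b (val (rho1 h a)))),
      is_base_change polyZ_to_Zhalf b' /\ hecke_rep rho',
      (forall h (a : Asub HZ), exists2 a' : Asub Hhalf,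
         val a' = b' (val a)
         & val (rho' (b' h) a') = b' (val (rho1 h a)))
    & [/\ is_bernstein theta,
          (forall h f, theta (sigma h f) = rho' h (theta f)),
          is_classical_spherical theta sigma
        & forall sigma', is_classical_spherical theta sigma' ->
            forall h, sigma' h =1 sigma h]].

(* Main.v *)
(* Write [A] for the commutative subalgebra. Since [S = Y z_2^-1 U] and
   [U S = X + c_s U], the algebra is [A + A U]. For every character [l] of the
   torus there is an explicit principal series representation by 2 x 2 matrices
   over [K[x, y, z^{+-1}] / (x y = qq z)], in which [A] acts triangularly and
   [U] is off-diagonal; the diagonal entries recover [A] because they have a
   left inverse on every component. Hence the sum [A + A U] is direct, and the relation
   [U a = s(a) U + r(a)] defines the action [s] of W_0 on [A] and a twisted
   derivation [r] with [(Y - X) r(a) = z_2 c_s (a - s(a))], so that [r] is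
   governed by the divided difference.
   For a suitable [u0] in [A] with [s(u0) u0 + r(u0) = z_2], the left ideal
   generated by [U - u0] is [A (U - u0)], a complement of [A]; the representation
   is the action on the quotient. Faithfulness and uniqueness come down to
   [X - Y], [z_2 - X^2] and [Y] not being zero divisors, which is read off from
   norms to [K[X + Y, z^{+-1}]]. A faithful representation extending the multiplication
   of [A] is automatically linear over the center, since every central element
   then lies in [A]. *)
Require Import Defs.
From HB Require Import structures.
From mathcomp Require Import all_boot all_order all_algebra all_fingroup all_field.
From mathcomp Require Import all_solvable all_character.
From mathcomp Require Import boolp.
From mathcomp Require Import ssrAC ring.
Import GRing.Theory Num.Theory.
Local Open Scope ring_scope.

Set Implicit Arguments.
Unset Strict Implicit.
Unset Printing Implicit Defensive.

(** * Presented algebras *)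

(** Equality in these algebras is a generated congruence, so elements can only be told apart by
    mapping out of the algebra; this is the task of the principal series. The element [u0] is the
    image of 1 under [U], and it is forced. Since S = Y z_2^-1 U, condition (ii) prescribes Y z_2^-1
    U(e) for the idempotents e. On a non-regular component -D_s(q) sends 1 to q, so Y u0 = q z_2 = Y
    X and u0 = X. On a regular one V_s(q) sends eps_1 to z_2^-1 Y eps_2 and eps_2 to Y eps_1, so U
    eps_1 = eps_2 and U eps_2 = z_2 eps_1. The equation s(u0) u0 + r(u0) = z_2 says that U^2 maps 1
    to z_2. The component rings are not assumed to be domains, and A has idempotents; cancellation
    therefore goes through explicit norms, monic in X + Y for X - Y and z_2 - X^2, which cancel over
    any commutative ring. The interface [hecke_like] is shared by the pro-p algebra and by the
    Iwahori-Hecke algebras over all coefficient rings, so that one construction yields all the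
    representations to be compared. *)

Section UniversalProperty.
Variables (K : comNzRingType) (I : Type) (P : presentation K I).

Lemma pres_classC k : pres_class P (Cst k) = k *: 1.
Proof.
rewrite [RHS]pres_scaleE; apply/pres_classP/algeq_sym.
by apply: algeq_trans (algeq_cstM _ _ _) _; rewrite mulr1; apply: algeq_refl.
Qed.

Lemma pres_class_rel x y : pres_rel P x y -> pres_class P x = pres_class P y.
Proof. by move=> xy; apply/pres_classP/algeq_rel. Qed.

Lemma presAlg_ind (Q : presAlg P -> Prop) :
  (forall k, Q (k *: 1)) -> (forall i, Q (pgen P i)) ->
  (forall x y, Q x -> Q y -> Q (x + y)) ->
  (forall x y, Q x -> Q y -> Q (x * y)) -> forall x, Q x.
Proof.
move=> Qk Qi QD QM; elim/pres_ind; elim=> [k|i|x Qx y Qy|x Qx y Qy].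
- by rewrite pres_classC.
- exact: Qi.
- by rewrite pres_classD; apply: QD.
- by rewrite pres_classM; apply: QM.
Qed.

Section Lift.
Variables (L : nzRingType) (phi : {rmorphism K -> L}) (g : I -> L).

(** [eval] requires a commutative target; here values in matrix rings and in Hecke algebras are
    needed, with only the scalars [phi k] central. *)
Fixpoint nceval (x : expr K I) : L :=
  match x with
  | Cst a => phi a
  | Gen i => g i
  | Add x y => nceval x + nceval y
  | Mul x y => nceval x * nceval y
  end.

Hypothesis phiC : forall k y, phi k * y = y * phi k.
Hypothesis relP : forall x y, pres_rel P x y -> nceval x = nceval y.

Lemma nceval_algeq x y : algeq (pres_rel P) x y -> nceval x = nceval y.
Proof.
elim=> //=.
- by move=> ? ? ? _ -> _ ->.
- by move=> ? ? ? ? _ -> _ ->.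
- by move=> ? ? ? ? _ -> _ ->.
- by move=> *; rewrite addrA.
- by move=> *; rewrite addrC.
- by move=> *; rewrite rmorph0 add0r.
- by move=> *; rewrite mulrA.
- by move=> *; rewrite rmorph1 mul1r.
- by move=> *; rewrite rmorph0 mul0r.
- by move=> *; rewrite mulrDl.
- by move=> *; rewrite mulrDr.
- by move=> *; rewrite rmorphD.
- by move=> *; rewrite rmorphM.
Qed.

Definition lift_fun (x : presAlg P) : L := nceval (pres_repr x).

Lemma lift_class x : lift_fun (pres_class P x) = nceval x.
Proof. exact/nceval_algeq/pres_repr_class. Qed.

(** The universal property is semilinear along [phi], so that changes of the coefficient ring are
    instances of it too. *)
Lemma presAlg_lift : exists f : {rmorphism presAlg P -> L},
  (forall k x, f (k *: x) = phi k * f x) /\ forall i, f (pgen P i) = g i.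
Proof.
have fZ k x : lift_fun (k *: x) = phi k * lift_fun x.
  by elim/pres_ind: x => x; rewrite [_ *: _]pres_scaleE !lift_class.
have f0 : lift_fun 0 = 0 by rewrite lift_class /= rmorph0.
have fD : {morph lift_fun : x y / x + y}.
  by elim/pres_ind=> x; elim/pres_ind=> y; rewrite -pres_classD !lift_class.
have fN : zmod_morphism lift_fun.
  by move=> x y; rewrite fD -[- y]scaleN1r fZ rmorphN rmorph1 mulN1r.
have f1 : lift_fun 1 = 1 by rewrite lift_class /= rmorph1.
have fM : {morph lift_fun : x y / x * y}.
  by elim/pres_ind=> x; elim/pres_ind=> y; rewrite -pres_classM !lift_class.
pose fa := GRing.isZmodMorphism.Build _ _ lift_fun fN.
pose fm := GRing.isMonoidMorphism.Build _ _ lift_fun (conj f1 fM).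
pose f : {rmorphism presAlg P -> L} := HB.pack lift_fun fa fm.
by exists f; split=> // i; rewrite /f /= lift_class.
Qed.

End Lift.

Lemma presAlg_lift_alg (L : algType K) (g : I -> L) :
  (forall x y, pres_rel P x y -> nceval (in_alg L) g x = nceval (in_alg L) g y) ->
  exists f : {lrmorphism presAlg P -> L}, forall i, f (pgen P i) = g i.
Proof.
move=> relP.
have phiC k (y : L) : in_alg L k * y = y * in_alg L k.
  by rewrite /= mulr_algl mulr_algr.
have [f [fZ fg]] := presAlg_lift phiC relP.
have fZ' : scalable f by move=> k x; rewrite fZ mulr_algl.
pose fs := GRing.isScalable.Build _ _ _ _ f fZ'.
by exists (HB.pack (f : _ -> _) f fs : {lrmorphism presAlg P -> L}).
Qed.

End UniversalProperty.

(** * Two by two matrices *)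

Section Matrix2.
Variable R : nzRingType.

Definition mk2 (a b c d : R) : 'M[R]_2 :=
  \matrix_(i, j) if i == 0 then (if j == 0 then a else b)
                 else (if j == 0 then c else d).

Lemma mk2_mul a b c d a' b' c' d' :
  mk2 a b c d * mk2 a' b' c' d' =
  mk2 (a * a' + b * c') (a * b' + b * d') (c * a' + d * c') (c * b' + d * d').
Proof.
apply/matrixP=> i j; rewrite !mxE !big_ord_recl big_ord0 !mxE /= addr0.
by case: (i == 0); case: (j == 0).
Qed.

Lemma mk2_add a b c d a' b' c' d' :
  mk2 a b c d + mk2 a' b' c' d' = mk2 (a + a') (b + b') (c + c') (d + d').
Proof. by apply/matrixP=> i j; rewrite !mxE; case: (i == 0); case: (j == 0). Qed.

Lemma mk2_opp a b c d : - mk2 a b c d = mk2 (- a) (- b) (- c) (- d).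
Proof. by apply/matrixP=> i j; rewrite !mxE; case: (i == 0); case: (j == 0). Qed.

Lemma mul2E (M N : 'M[R]_2) i j : (M * N) i j = M i 0 * N 0 j + M i 1 * N 1 j.
Proof.
rewrite !mxE !big_ord_recl big_ord0 addr0.
by congr (M _ _ * N _ _ + M _ _ * N _ _); apply: val_inj.
Qed.

Lemma mk2_scalar k : k%:M = mk2 k 0 0 k.
Proof.
apply/matrixP=> i j; rewrite !mxE.
by case: i j => [[|[|[]]] //= ?] [[|[|[]]] //= ?].
Qed.

Lemma mk2_one : 1 = mk2 1 0 0 1.
Proof. exact: mk2_scalar. Qed.

Lemma mk2_eta (M : 'M[R]_2) : M = mk2 (M 0 0) (M 0 1) (M 1 0) (M 1 1).
Proof.
apply/matrixP=> i j; rewrite !mxE.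
by case: i j => [[|[|[]]] //= ?] [[|[|[]]] //= ?]; congr (M _ _); apply: val_inj.
Qed.

Lemma mk2_inj a b c d a' b' c' d' : mk2 a b c d = mk2 a' b' c' d' ->
  [/\ a = a', b = b', c = c' & d = d'].
Proof.
move=> e; have E i j := congr1 (fun M : 'M_2 => M i j) e.
by move: (E 0 0) (E 0 1) (E 1 0) (E 1 1); rewrite !mxE.
Qed.

Lemma mk2_scale k a b c d :
  k%:M * mk2 a b c d = mk2 (k * a) (k * b) (k * c) (k * d).
Proof. by rewrite mk2_scalar mk2_mul !mul0r !addr0 !add0r. Qed.

Lemma mk2E a b c d :
  ((mk2 a b c d 0 0 = a) * (mk2 a b c d 0 1 = b) *
   (mk2 a b c d 1 0 = c) * (mk2 a b c d 1 1 = d))%type.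
Proof. by rewrite !mxE. Qed.

End Matrix2.

(** * The component ring *)

Section IntegerPowers.
Variables (R : nzRingType) (u ui : R).
Hypotheses (uK : u * ui = 1) (Ku : ui * u = 1).

(** The inverse is an argument, since the rings concerned carry no unit structure; the clauses are
    those of [z2pow]. *)
Definition ipow (n : int) : R :=
  match n with Posz m => u ^+ m | Negz m => ui ^+ m.+1 end.

Lemma ipowS n : ipow (n + 1) = ipow n * u.
Proof.
case: n => [m|[|m]].
- by rewrite -PoszD addn1 /= exprSr.
- by rewrite (_ : Negz 0 + 1 = 0) //= expr1 Ku.
- rewrite (_ : Negz m.+1 + 1 = Negz m) /=; first by rewrite [in RHS]exprSr -mulrA Ku mulr1.
  by rewrite !NegzE -[m.+2]addn1 PoszD opprD subrK.
Qed.

Lemma ipowP n : ipow (n - 1) = ipow n * ui.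
Proof. by rewrite -[in RHS](subrK 1 n) ipowS -mulrA uK mulr1. Qed.

Lemma ipowD m n : ipow (m + n) = ipow m * ipow n.
Proof.
elim/int_rec: n => [|n IHn|n IHn]; first by rewrite addr0 mulr1.
- by rewrite -addn1 PoszD addrA !ipowS IHn mulrA.
- by rewrite -addn1 PoszD opprD addrA !ipowP IHn mulrA.
Qed.

End IntegerPowers.

Lemma rmorph_ipow (R R' : nzRingType) (f : {rmorphism R -> R'}) u ui n :
  f (ipow u ui n) = ipow (f u) (f ui) n.
Proof. by case: n => m; rewrite rmorphXn. Qed.

Section GroupRingLemmas.
Variables (K : comNzRingType) (G : zmodType).

Lemma gexp0 : gexp K 0 = 1 :> groupRing K G.
Proof. exact/pres_classP/(algeq_rel (group_rel0 K G)). Qed.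

Lemma groupRing_ind (Q : groupRing K G -> Prop) :
  (forall x y, Q x -> Q y -> Q (x + y)) ->
  (forall k x, Q x -> Q (k *: x)) ->
  (forall g, Q (gexp K g)) -> forall x, Q x.
Proof.
move=> QD Qk Qg x; rewrite -[x]mulr1.
(* [Q] is not assumed stable under products. The strengthened claim, that multiplying by [x]
   preserves the validity of [Q] on all translates, passes to products by composition. *)
suff: forall y, (forall g, Q (gexp K g * y)) -> forall g, Q (gexp K g * (x * y)).
  by move/(_ 1 _ 0); rewrite gexp0 mul1r; apply=> g; rewrite mulr1.
elim/presAlg_ind: x => [k|h|x y IHx IHy|x y IHx IHy] t Qt g.
- by rewrite -scalerAl mul1r -scalerAr; apply: Qk.
- by rewrite mulrA -[pgen _ h]/(gexp K h) -gexpD.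
- by rewrite mulrDl mulrDr; apply: QD; [apply: IHx | apply: IHy].
- by rewrite -mulrA; apply: IHx; apply: IHy.
Qed.

Lemma groupRing_lift (L : algType K) (g : G -> L) :
  g 0 = 1 -> (forall a b, g (a + b) = g a * g b) ->
  exists f : {lrmorphism groupRing K G -> L}, forall a, f (gexp K a) = g a.
Proof.
move=> g0 gD.
have [|f fg] := @presAlg_lift_alg K G (group_pres K G) L g.
  by move=> x y [|a b] /=; rewrite ?g0 ?scale1r ?gD.
by exists f.
Qed.

Lemma gexp_ipow g w n : gexp K g * w = 1 :> groupRing K G ->
  gexp K (g *~ n) = ipow (gexp K g) w n.
Proof.
move=> gw; have wg : w * gexp K g = 1 by rewrite mulrC.
have gV : gexp K (- g) = w.
  by rewrite -[LHS]mulr1 -gw mulrA -gexpD addNr gexp0 mul1r.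
elim/int_rec: n => [|n IHn|n IHn]; first by rewrite mulr0z gexp0.
  by rewrite -addn1 PoszD (ipowS wg) mulrzDr gexpD IHn mulr1z.
by rewrite -addn1 PoszD opprD (ipowP gw wg) mulrzDr gexpD IHn mulrNz mulr1z gV.
Qed.

End GroupRingLemmas.

(* [K[x, y, z^{+-1}] / (x y = qq z)]: the component of the commutative
   subalgebra at one character of the torus. *)
Section ComponentRing.
Variables (K : comNzRingType) (qq : K).

Inductive comp_gen := Bx | By | Bz | Bi.

Local Notation E := (expr K comp_gen).

Inductive comp_rel : E -> E -> Prop :=
| comp_relC i j : comp_rel (Mul (Gen i) (Gen j)) (Mul (Gen j) (Gen i))
| comp_relM : comp_rel (Mul (Gen Bx) (Gen By)) (Mul (Cst qq) (Gen Bz))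
| comp_relV : comp_rel (Mul (Gen Bz) (Gen Bi)) (Cst 1).

Fact comp_relP : ~ algeq comp_rel (Cst 1) (Cst 0).
Proof.
apply: (@eval_consistent K K idfun _ (fun i => if i is Bx then qq else 1)).
by move=> x y [i j||] /=; rewrite ?mulr1 // mulrC.
Qed.

Definition comp_pres := Presentation comp_relP.
Definition compRing := presAlg comp_pres.
HB.instance Definition _ := GRing.Algebra.on compRing.

Fact compRing_mulC : commutative (@GRing.mul compRing).
Proof.
elim/presAlg_ind=> [k|i|x x' IHx IHx'|x x' IHx IHx'] y.
- by rewrite -scalerAl -scalerAr mul1r mulr1.
- elim/presAlg_ind: y => [k|j|y y' IHy IHy'|y y' IHy IHy'].
  + by rewrite -scalerAl -scalerAr mul1r mulr1.
  + by rewrite -!pres_classM; apply/pres_class_rel/comp_relC.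
  + by rewrite mulrDl mulrDr IHy IHy'.
  + by rewrite mulrA IHy -!mulrA IHy'.
- by rewrite mulrDl mulrDr IHx IHx'.
- by rewrite -mulrA IHx' mulrA IHx -mulrA.
Qed.

HB.instance Definition _ :=
  GRing.PzRing_hasCommutativeMul.Build compRing compRing_mulC.

Definition bx : compRing := pgen comp_pres Bx.
Definition by_ : compRing := pgen comp_pres By.
Definition bz : compRing := pgen comp_pres Bz.
Definition bi : compRing := pgen comp_pres Bi.

Lemma bxy : bx * by_ = qq%:A * bz.
Proof.
rewrite mulr_algl -[LHS]pres_classM (pres_class_rel (P := comp_pres) comp_relM).
by rewrite pres_classM pres_classC mulr_algl.
Qed.

Lemma bzi : bz * bi = 1.
Proof.
rewrite -[LHS]pres_classM (pres_class_rel (P := comp_pres) comp_relV).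
by rewrite pres_classC scale1r.
Qed.

Lemma compRing_ind (Q : compRing -> Prop) :
  (forall k, Q (k *: 1)) -> Q bx -> Q by_ -> Q bz -> Q bi ->
  (forall x y, Q x -> Q y -> Q (x + y)) ->
  (forall x y, Q x -> Q y -> Q (x * y)) -> forall x, Q x.
Proof.
move=> Qk Qx Qy Qz Qi QD QM.
by elim/presAlg_ind=> [k|[]|x y|x y] //; [apply: QD | apply: QM].
Qed.

Section Lift.
Variables (L : nzRingType) (phi : {rmorphism K -> L}) (x y z zi : L).
Hypothesis phiC : forall k y, phi k * y = y * phi k.
Hypotheses (xC : x * y = y * x) (xz : x * z = z * x) (xi : x * zi = zi * x).
Hypotheses (yz : y * z = z * y) (yi : y * zi = zi * y) (zC : z * zi = zi * z).
Hypotheses (xy : x * y = phi qq * z) (zK : z * zi = 1).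

Lemma compRing_lift : exists f : {rmorphism compRing -> L},
  (forall k b, f (k *: b) = phi k * f b) /\
  [/\ f bx = x, f by_ = y, f bz = z & f bi = zi].
Proof.
pose g i := match i with Bx => x | By => y | Bz => z | Bi => zi end.
have [|f [fZ fg]] := @presAlg_lift K comp_gen comp_pres L phi g phiC.
  by move=> a b [[] []||] //=; rewrite ?rmorph1.
by exists f; split=> //; rewrite !fg.
Qed.

End Lift.

Lemma compRing_lift_alg (L : algType K) (x y z zi : L) :
  x * y = y * x -> x * z = z * x -> x * zi = zi * x ->
  y * z = z * y -> y * zi = zi * y -> z * zi = zi * z ->
  x * y = qq *: z -> z * zi = 1 ->
  exists f : {lrmorphism compRing -> L},
  [/\ f bx = x, f by_ = y, f bz = z & f bi = zi].
Proof.
move=> xC xz xi yz yi zC xy zK.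
pose g i := match i with Bx => x | By => y | Bz => z | Bi => zi end.
have [|f fg] := @presAlg_lift_alg K comp_gen comp_pres L g.
  by move=> a b [[] []||] //=; rewrite ?scale1r ?mulr_algl.
by exists f; rewrite !fg.
Qed.

Local Notation Laurent := (groupRing K int).
Local Notation C := {poly Laurent}.

(* [Psi] is multiplication on [compRing], in the basis [1, y] over
   [K[x + y, z^{+-1}]]. *)
Lemma compRing_regular : exists (ev : {rmorphism C -> compRing})
    (Psi : {rmorphism compRing -> 'M[C]_2}),
  [/\ forall k, ev ((k%:A)%:P) = k%:A, ev 'X = bx + by_,
      ev ((gexp K 1)%:P) = bz,
      forall p, Psi (ev p) = p%:M &
      Psi by_ = mk2 0 (- (qq%:A)%:P * (gexp K 1)%:P) 1 'X].
Proof.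
have zK : bi * bz = 1 by rewrite mulrC bzi.
have [||zeta zetaE] := @groupRing_lift K int compRing (ipow bz bi).
- by [].
- exact: (ipowD bzi zK).
have cz : commr_rmorph zeta (bx + by_) by move=> a; apply: mulrC.
pose ev : {rmorphism C -> compRing} := horner_morph cz.
have evC a : ev a%:P = zeta a by apply: horner_morphC.
have evX : ev 'X = bx + by_ by apply: horner_morphX.
have gK : (gexp K 1 : Laurent) * gexp K (-1) = 1 by rewrite -gexpD subrr gexp0.
pose qc : C := (qq%:A)%:P.
pose zc : C := (gexp K 1)%:P; pose ic : C := (gexp K (-1))%:P.
have zic : zc * ic = 1 by rewrite -polyCM gK.
(* With 'X standing for x + y, the columns of [my] express y 1 = y and y y = (x + y) y - qq z; [mx]
   is 'X minus [my]. *)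
pose my := mk2 0 (- qc * zc) 1 'X; pose mx := mk2 'X (qc * zc) (-1) 0.
pose phi : {rmorphism K -> 'M[C]_2} :=
  (@scalar_mx C 2 \o (@polyC Laurent \o in_alg Laurent)).
have Msc (a b c d : C) k : mk2 a b c d * k%:M = mk2 (a * k) (b * k) (c * k) (d * k).
  by rewrite mk2_scalar mk2_mul !mulr0 !addr0 !add0r.
have MM (a b : C) : a%:M * b%:M = (a * b)%:M :> 'M_2 by rewrite scalar_mxM.
have phiC k M : phi k * M = M * phi k.
  by rewrite /= [M]mk2_eta mk2_scale Msc; congr mk2; apply: mulrC.
have [||||||||Psi [PsiZ [Psix Psiy Psiz Psii]]] :=
    @compRing_lift _ phi mx my zc%:M ic%:M phiC.
- by rewrite !mk2_mul; congr mk2; ring.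
- by rewrite mk2_scale Msc; congr mk2; ring.
- by rewrite mk2_scale Msc; congr mk2; ring.
- by rewrite mk2_scale Msc; congr mk2; ring.
- by rewrite mk2_scale Msc; congr mk2; ring.
- by rewrite !MM mulrC.
- by rewrite mk2_mul MM mk2_scalar; congr mk2; rewrite -/qc; ring.
- by rewrite MM zic.
exists ev, Psi; split=> //.
- by move=> k; rewrite evC linearZ rmorph1.
- by rewrite evC zetaE /= expr1.
elim/poly_ind=> [|p c IHp]; first by rewrite !rmorph0.
rewrite !rmorphD !rmorphM /= IHp evX evC rmorphD Psix Psiy mk2_add.
congr (_ * _ + _); first by rewrite mk2_scalar; congr mk2; ring.
elim/groupRing_ind: c => [a b IHa IHb|k a IHa|n].
- by rewrite !(rmorphD, raddfD) /= IHa IHb.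
- by rewrite linearZ PsiZ IHa /= MM -polyCM mulr_algl.
- rewrite zetaE rmorph_ipow Psiz Psii.
  have -> : gexp K n = ipow (gexp K 1 : Laurent) (gexp K (-1)) n.
    by rewrite -gexp_ipow // intz.
  by rewrite (rmorph_ipow (@polyC Laurent)) (rmorph_ipow (@scalar_mx C 2)).
Qed.

End ComponentRing.

Lemma monic_nzd (R : comNzRingType) (n p : {poly R}) :
  n \is monic -> n * p = 0 -> p = 0.
Proof. by move=> /monic_rreg nreg np; apply: nreg; rewrite mul0r mulrC. Qed.

(** * Non-zero-divisors of the component ring *)

Section ComponentRingRegular.
Variables (K : comNzRingType) (qq : K).
Local Notation Laurent := (groupRing K int).
Local Notation C := {poly Laurent}.
Local Notation B := (compRing qq).
Local Notation bx := (bx qq).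
Local Notation by_ := (by_ qq).
Local Notation bz := (bz qq).
Local Notation bi := (bi qq).

(** Here [w'] is a conjugate of [w] up to a unit and [n] a norm. Writing f = p0 + p1 y, the first
    column of the matrix of n f is (n p0, n p1), so w f = 0 forces both coordinates to vanish. *)
Lemma compRing_norm : exists ev : {rmorphism C -> B},
  [/\ forall k, ev ((k%:A)%:P) = k%:A, ev 'X = bx + by_,
      ev ((gexp K 1)%:P) = bz &
      forall w w' n, w * w' = ev n -> (forall p, n * p = 0 -> p = 0) ->
        forall f, w * f = 0 -> f = 0].
Proof.
have [ev [Psi [evk evX evz Psie Psiy]]] := compRing_regular qq.
exists ev; split=> // w w' n ww' nreg f wf0.
have evi : ev (gexp K (-1))%:P = bi.
  have e1 : bz * ev (gexp K (-1))%:P = 1.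
    by rewrite -evz -rmorphM -polyCM -gexpD subrr gexp0 rmorph1.
  by rewrite -[LHS]mul1r -(bzi qq) mulrAC e1 mul1r.
have [p0 [p1 fE]] : exists p0 p1, f = ev p0 + ev p1 * by_.
  elim/compRing_ind: f {wf0} => [k|||||x y [p0 [p1 ->]] [r0 [r1 ->]]
      |x y [p0 [p1 ->]] [r0 [r1 ->]]].
  - by exists (k%:A)%:P, 0; rewrite rmorph0 mul0r addr0 evk.
  - by exists 'X, (-1); rewrite evX rmorphN1; ring.
  - by exists 0, 1; rewrite rmorph0 rmorph1; ring.
  - by exists (gexp K 1)%:P, 0; rewrite rmorph0 evz; ring.
  - by exists (gexp K (-1))%:P, 0; rewrite rmorph0 evi; ring.
  - by exists (p0 + r0), (p1 + r1); rewrite !rmorphD; ring.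
  exists (p0 * r0 - p1 * r1 * ((qq%:A)%:P * (gexp K 1)%:P)).
  exists (p0 * r1 + p1 * r0 + p1 * r1 * 'X).
  rewrite !(rmorphD, rmorphN, rmorphM) /= evk evX evz -bxy; ring.
have : Psi (ev n * f) = 0 by rewrite -ww' mulrAC wf0 mul0r rmorph0.
rewrite fE mulrDr mulrA !(rmorphD, rmorphM) /= !Psie Psiy !mk2_scalar !mk2_mul.
rewrite mk2_add => e0.
have m0 : 0 = mk2 0 0 0 0 :> 'M[C]_2 by rewrite -mk2_scalar raddf0.
have /mk2_inj[] := etrans e0 m0.
rewrite !(mulr0, mul0r, addr0, add0r, mulr1) => np0 _ np1 _.
by rewrite (nreg _ np0) (nreg _ np1) rmorph0 mul0r addr0.
Qed.

(** The norm is (x - y)^2 = (x + y)^2 - 4 qq z, monic in x + y. *)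
Lemma bxBy_nzd (f : B) : (bx - by_) * f = 0 -> f = 0.
Proof.
have [ev [evk evX evz]] := compRing_norm.
move/(_ (bx - by_) (bx - by_) ('X^2 - (4%:R * gexp K 1 * qq%:A)%:P)).
apply=> [|p]; last by apply: monic_nzd; apply: monicXnsubC.
rewrite rmorphB rmorphXn evX !rmorphM rmorph_nat /= evk evz.
have := bxy qq; set q1 := qq%:A => e; ring: e.
Qed.

(** From x y = qq z one gets (z - x^2)(z - y^2) = z ((1 + qq)^2 z - (x + y)^2); division by -z makes
    it monic in x + y. *)
Lemma bzBx2_nzd (f : B) : (bz - bx ^+ 2) * f = 0 -> f = 0.
Proof.
have [ev [evk evX evz]] := compRing_norm.
move/(_ (bz - bx ^+ 2) (- (bz - by_ ^+ 2) * bi)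
  ('X^2 - ((1 + qq%:A) ^+ 2 * gexp K 1)%:P)).
apply=> [|p]; last by apply: monic_nzd; apply: monicXnsubC.
rewrite rmorphB rmorphXn evX !(rmorphM, rmorphD, rmorph1) /= evk evz.
have := bxy qq; have := bzi qq; set q1 := qq%:A => e e'; ring: e e'.
Qed.

(** The norm y x z^-1 = qq is a constant rather than a monic polynomial, whence the hypothesis on
    [qq]. *)
Lemma by_nzd : (forall p : Laurent, qq *: p = 0 -> p = 0) ->
  forall f : B, by_ * f = 0 -> f = 0.
Proof.
move=> qreg f; have [ev [evk evX evz]] := compRing_norm.
move/(_ by_ (bx * bi) (qq%:A)%:P); apply.
  by rewrite evk mulrA [by_ * _]mulrC bxy -mulrA bzi mulr1.
move=> p /polyP qp0; apply/polyP=> i; rewrite coef0; apply: qreg.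
by have := qp0 i; rewrite coefCM coef0 mulr_algl.
Qed.

End ComponentRingRegular.

(** * Matrices of the principal series *)

Section PrincipalSeries.
Variables (K : comNzRingType) (qq : K).
Local Notation B := (compRing qq).
Local Notation M := 'M[B]_2.

Definition psT (k k' : K) : M := mk2 k%:A 0 0 k'%:A.
(** In the basis (v, U v), where X, Y, z_2, c act on v by x, y, z, k: the relation X = U (S - c)
    gives S v = k v + x z^-1 U v, and S U v = Y v = y v. Likewise U (U v) = z v gives [psU]. *)
Definition psS (k : K) : M := mk2 k%:A (by_ qq) (bx qq * bi qq) 0.
Definition psU : M := mk2 0 (bz qq) 1 0.
Definition psV : M := mk2 0 1 (bi qq) 0.
Definition ps_scalar : {rmorphism K -> M} := (@scalar_mx B 2 \o in_alg B).

Lemma ps_scalarE k : ps_scalar k = psT k k.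
Proof. exact: mk2_scalar. Qed.

Lemma ps_scalarC k m : ps_scalar k * m = m * ps_scalar k.
Proof.
by rewrite ps_scalarE [m]mk2_eta !mk2_mul; congr mk2; ring.
Qed.

Lemma psTM k k' l l' : psT k k' * psT l l' = psT (k * l) (k' * l').
Proof.
by rewrite mk2_mul !(mulr0, mul0r, addr0, add0r) !mulr_algl !scalerA.
Qed.

Lemma psTD k k' l l' : psT k k' + psT l l' = psT (k + l) (k' + l').
Proof. by rewrite mk2_add !addr0 -!scalerDl. Qed.

Lemma psT1 : psT 1 1 = 1.
Proof. by rewrite -ps_scalarE rmorph1. Qed.

Lemma psUV : psU * psV = 1.
Proof. by rewrite mk2_mul mk2_one; have e := bzi qq; congr mk2; ring: e. Qed.

Lemma psVU : psV * psU = 1.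
Proof. by rewrite mk2_mul mk2_one; have e := bzi qq; congr mk2; ring: e. Qed.

Lemma psUUS k : psU * psU * psS k = psS k * (psU * psU).
Proof. by rewrite !mk2_mul; congr mk2; ring. Qed.

Lemma psSS k : psS k * psS k = ps_scalar qq + psT k k * psS k.
Proof.
rewrite ps_scalarE !mk2_mul mk2_add; have e := bxy qq; have e' := bzi qq.
by move: (k%:A) => k'; move: (qq%:A) e => q' e; congr mk2; ring: e e'.
Qed.

(** Only the diagonal entry [k] obstructs the commutation; the hypothesis is the shadow of c T_i = c
    T_(s i). *)
Lemma psST k l l' : k * l = k * l' -> psS k * psT l l' = psT l' l * psS k.
Proof.
move=> e; rewrite !mk2_mul !(mulr0, mul0r, addr0, add0r).
by congr mk2; rewrite [LHS]mulrC // !mulr_algl !scalerA ![_ * k]mulrC e.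
Qed.

Lemma psUT l l' : psU * psT l l' = psT l' l * psU.
Proof. by rewrite !mk2_mul; congr mk2; ring. Qed.

End PrincipalSeries.

(** * Bernstein presentation *)

Lemma subalg_ind (K : comNzRingType) (H : heckeData K) (Q : Asub H -> Prop) :
  (forall k, Q (k *: 1)) -> (forall i, Q (aT i)) -> Q (aX H) -> Q (aY H) ->
  Q (az H) -> Q (azV H) -> (forall x y, Q x -> Q y -> Q (x + y)) ->
  (forall x y, Q x -> Q y -> Q (x * y)) -> forall a, Q a.
Proof.
move=> Q1 QT QX QY Qz QzV QD QM.
have Qeq (x y : Asub H) : val x = val y -> Q y -> Q x by move/val_inj->.
have lift x : in_subalg (@A_gen K H) x -> exists x' : Asub H, val x' = x.
  by move=> /asboolP Ax; exists (Sub x Ax).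
suff QA x : in_subalg (@A_gen K H) x -> forall a : Asub H, val a = x -> Q a.
  by move=> a; apply: (QA (val a)) => //; apply/asboolP; apply: (valP a).
elim=> {x} [x||x y Ax Qx Ay Qy|x y Ax Qx Ay Qy|k x Ax Qx].
- case=> [i||||] a ea.
  + by apply: (Qeq _ (aT i) ea).
  + by apply: (Qeq _ (aX H) ea).
  + by apply: (Qeq _ (aY H) ea).
  + by apply: (Qeq _ (az H) ea).
  + by apply: (Qeq _ (azV H) ea).
- move=> a ea; apply: (Qeq _ (1 *: 1)). by rewrite scale1r.
  exact: Q1.
- move=> a ea; have [[x' ex] [y' ey]] := (lift x Ax, lift y Ay).
  by apply: (Qeq _ (x' + y')); [rewrite ea -ex -ey | apply: QD; [apply: Qx | apply: Qy]].
- move=> a ea; have [[x' ex] [y' ey]] := (lift x Ax, lift y Ay).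
  by apply: (Qeq _ (x' * y')); [rewrite ea -ex -ey | apply: QM; [apply: Qx | apply: Qy]].
- move=> a ea; have [x' ex] := lift x Ax.
  apply: (Qeq _ (k *: 1 * x')); last by apply: QM; [apply: Q1 | apply: Qx].
  by rewrite ea -ex -scalerAl mul1r.
Qed.

Section Characters.
Variables (K : comNzRingType) (H : heckeData K) (qq : K) (Lam : finType).
Variables (lam : Lam -> hidx H -> K) (sw : Lam -> Lam) (cl : Lam -> K).
Variables (eps : Lam -> Asub H) (aC : Asub H).
Local Notation B := (compRing qq).
Local Notation T := (@hT K H).
Local Notation S := (hS H).
Local Notation U := (hU H).
Local Notation V := (hV H).
Local Notation c := (hc H).
Local Notation sT := (@hswap K H).

(** [Lam] indexes characters of the T_i, [eps] the matching weight idempotents, and [cl l] is the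
    value of c at [l]. For the Iwahori-Hecke algebra there are no T_i and [Lam] is a point. *)
Record hecke_like : Prop := HeckeLike {
  hl_TT : forall i j, T i * T j = T j * T i;
  hl_sK : involutive sT;
  hl_ST : forall i, S * T i = T (sT i) * S;
  hl_UT : forall i, U * T i = T (sT i) * U;
  hl_UV : U * V = 1;
  hl_VU : V * U = 1;
  hl_UUS : U * U * S = S * (U * U);
  hl_SS : S * S = qq%:A + c * S;
  hl_c : val aC = c;
  hl_cS : c * S = S * c;
  hl_cU : c * U = U * c;
  hl_cT : forall i, c * T i = T i * c;
  hl_cTT : forall i, c * T i = c * T (sT i);
  hl_ind : forall Q : H -> Prop, (forall k, Q (k *: 1)) -> (forall i, Q (T i)) ->
    Q S -> Q U -> Q V -> (forall x y, Q x -> Q y -> Q (x + y)) ->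
    (forall x y, Q x -> Q y -> Q (x * y)) -> forall h, Q h;
  hl_swK : involutive sw;
  hl_lam : forall l i, lam (sw l) i = lam l (sT i);
  hl_eps : forall l i, eps l * aT i = lam l i *: eps l;
  hl_sum : \sum_l eps l = 1;
  (* The principal series at the character l, in a basis (v, U v) with v an
     eigenvector of the commutative subalgebra. *)
  hl_Phi : forall l, exists2 Phi : {rmorphism H -> 'M[B]_2},
    forall k h, Phi (k *: h) = ps_scalar qq k * Phi h &
    [/\ forall i, Phi (T i) = psT qq (lam l i) (lam l (sT i)),
        Phi U = psU qq, Phi V = psV qq, Phi S = psS qq (cl l)
      & Phi c = psT qq (cl l) (cl l)] }.

Hypothesis hyp : hecke_like.

Lemma hl_TS i : T i * S = S * T (sT i).
Proof. by rewrite hl_ST // hl_sK. Qed.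

Lemma hl_TU i : T i * U = U * T (sT i).
Proof. by rewrite hl_UT // hl_sK. Qed.

Lemma hz_central h : hz H * h = h * hz H.
Proof.
rewrite /hz expr2; elim/(hl_ind hyp): h => [k|i||||x y ex ey|x y ex ey].
- by rewrite -scalerAr mulr1 -scalerAl mul1r.
- by rewrite -mulrA hl_UT // mulrA hl_UT // hl_sK // -mulrA.
- exact: hl_UUS.
- by rewrite mulrA.
- by rewrite -mulrA hl_UV // mulrA hl_VU // mulr1 mul1r.
- by rewrite mulrDl mulrDr ex ey.
- by rewrite mulrA ex -mulrA ey mulrA.
Qed.

Lemma hz_hzV : hz H * hzV H = 1.
Proof.
by rewrite /hz /hzV !expr2 mulrA -(mulrA U U V) hl_UV // mulr1 hl_UV.
Qed.

Lemma hzV_hz : hzV H * hz H = 1.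
Proof. by rewrite -hz_central hz_hzV. Qed.

Lemma hzV_central h : hzV H * h = h * hzV H.
Proof.
rewrite -[LHS]mulr1 -hz_hzV mulrA -(mulrA _ h) -hz_central mulrA hzV_hz.
by rewrite mul1r.
Qed.

Lemma hV_E : V = hzV H * U.
Proof. by rewrite /hzV expr2 -mulrA hl_VU // mulr1. Qed.

Lemma hS_E : S = hY H * hzV H * U.
Proof. by rewrite -mulrA -hV_E /hY -mulrA hl_UV // mulr1. Qed.

Lemma hUS_E : U * S = hX H + c * U.
Proof. by rewrite /hX mulrBr hl_cU // subrK. Qed.

Lemma hXY : hX H * hY H = qq *: hz H.
Proof.
rewrite /hX /hY /hz mulrA -(mulrA U) mulrBl hl_SS // addrK -mulrA mulr_algl.
by rewrite -scalerAr.
Qed.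

Lemma hYX : hY H * hX H = qq *: hz H.
Proof.
rewrite /hX /hY mulrA -(mulrA S) -expr2 -/(hz H) -hz_central -mulrA mulrBr.
by rewrite hl_SS // -hl_cS // addrK mulr_algr.
Qed.

Lemma hXS : hX H * S = qq *: U.
Proof. by rewrite /hX -mulrA mulrBl hl_SS // addrK mulr_algr. Qed.

Lemma hTX i : T i * hX H = hX H * T i.
Proof.
rewrite /hX mulrA hl_TU -!mulrA; congr (_ * _).
by rewrite mulrBr mulrBl hl_ST // hl_cTT // hl_cT.
Qed.

Lemma hTY i : T i * hY H = hY H * T i.
Proof. by rewrite /hY mulrA hl_TS -!mulrA hl_UT. Qed.

Lemma aval_inj (a b : Asub H) : val a = val b -> a = b.
Proof. exact: val_inj. Qed.

Lemma avalD (a b : Asub H) : val (a + b) = val a + val b. Proof. by []. Qed.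
Lemma avalM (a b : Asub H) : val (a * b) = val a * val b. Proof. by []. Qed.
Lemma avalZ k (a : Asub H) : val (k *: a) = k *: val a. Proof. by []. Qed.
Lemma avalN (a : Asub H) : val (- a) = - val a. Proof. by []. Qed.

Lemma aval0 : val (0 : Asub H) = 0. Proof. by []. Qed.
Lemma aval1 : val (1 : Asub H) = 1. Proof. by []. Qed.

Lemma aXY : aX H * aY H = qq *: az H.
Proof. exact/aval_inj/hXY. Qed.

Lemma azC a : az H * a = a * az H.
Proof. exact/aval_inj/hz_central. Qed.

Lemma az_azV : az H * azV H = 1.
Proof. exact/aval_inj/hz_hzV. Qed.

Lemma azV_az : azV H * az H = 1.
Proof. exact/aval_inj/hzV_hz. Qed.

Lemma azVC a : azV H * a = a * azV H.
Proof. exact/aval_inj/hzV_central. Qed.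

Lemma Asub_mulC (a b : Asub H) : a * b = b * a.
Proof.
have comm_ind (d : Asub H) : (forall i, aT i * d = d * aT i) ->
    aX H * d = d * aX H -> aY H * d = d * aY H -> forall e, e * d = d * e.
  move=> dT dX dY; elim/subalg_ind=> [k|i|||||x y ex ey|x y ex ey] //.
  - by rewrite -scalerAl -scalerAr mul1r mulr1.
  - exact: azC.
  - exact: azVC.
  - by rewrite mulrDl mulrDr ex ey.
  - by rewrite -mulrA ey mulrA ex mulrA.
have aTX i : aT i * aX H = aX H * aT i by apply/aval_inj/hTX.
have aTY i : aT i * aY H = aY H * aT i by apply/aval_inj/hTY.
have aXYC : aX H * aY H = aY H * aX H.
  by apply/aval_inj; rewrite [LHS]hXY [RHS]hYX.
have TT (i j : hidx H) : aT i * aT j = aT j * aT i by apply: aval_inj; apply: (hl_TT hyp).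
by apply: (comm_ind) => [i||]; apply/esym/comm_ind => // *; rewrite ?aTX ?aTY ?aXYC.
Qed.

Lemma aC_val : val aC = c. Proof. exact: (hl_c hyp). Qed.

Lemma hcoord_ex h : exists p : Asub H * Asub H, h = val p.1 + val p.2 * U.
Proof.
(* The sum A + A U is shown stable under right multiplication. On that side U only meets generators,
   so that no rule for U a with a general a in A is needed yet. *)
suff /(_ 1 0) [p] : forall a b : Asub H,
    exists p : Asub H * Asub H, (val a + val b * U) * h = val p.1 + val p.2 * U.
  by rewrite rmorph0 mul0r addr0 rmorph1 mul1r; exists p.
elim/(hl_ind hyp): h => [k|i||||x y IHx IHy|x y IHx IHy] a b.
- exists (k *: a, k *: b); rewrite !avalZ -scalerAr mulr1.
  by rewrite scalerDr scalerAl.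
- exists (a * aT i, b * aT (sT i)).
  by rewrite !avalM mulrDl -mulrA hl_UT // !mulrA.
- exists (b * aX H, a * aY H * azV H + b * aC).
  rewrite mulrDl -mulrA hUS_E !(avalD, avalM) aC_val.
  rewrite {1}hS_E !mulrDl mulrDr !mulrA addrC -!addrA; congr (_ + _).
  by rewrite addrC.
- exists (b * az H, a).
  by rewrite mulrDl -mulrA -expr2 addrC avalM.
- exists (b, a * azV H); rewrite mulrDl -mulrA hl_UV // mulr1 addrC {1}hV_E mulrA.
  by rewrite avalM.
- have [[p q] e] := IHx a b; have [[p' q'] e'] := IHy a b.
  by exists (p + p', q + q'); rewrite mulrDr e e' !avalD mulrDl addrACA.
- have [[p q] e] := IHx a b; have [[p' q'] e'] := IHy p q.
  by exists (p', q'); rewrite mulrA e e'.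
Qed.

Lemma theta_ex : exists th : {lrmorphism B -> Asub H},
  [/\ th (bx qq) = aX H, th (by_ qq) = aY H, th (bz qq) = az H & th (bi qq) = azV H].
Proof.
by apply: compRing_lift_alg; do ?[exact: Asub_mulC|exact: aXY|exact: az_azV].
Qed.

(** The second basis vector U v sees X and Y exchanged; this map undoes the second diagonal entry of
    the principal series. *)
Lemma theta'_ex : exists th : {lrmorphism B -> Asub H},
  [/\ th (bx qq) = aY H, th (by_ qq) = aX H, th (bz qq) = az H & th (bi qq) = azV H].
Proof.
apply: compRing_lift_alg; do ?[exact: Asub_mulC|exact: az_azV].
by rewrite Asub_mulC aXY.
Qed.

(** The vector v has weight [l] and U v has weight [sw l]. Diagonal entries of triangular matrices
    are multiplicative, so that it suffices to compare on generators of A. *)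
Lemma Phi_triang l : exists2 Phi : {rmorphism H -> 'M[B]_2},
  (forall k h, Phi (k *: h) = ps_scalar qq k * Phi h) /\
  [/\ Phi U = mk2 0 (bz qq) 1 0, Phi (hX H) 0 0 = bx qq, Phi (hY H) 0 0 = by_ qq
    & Phi (hz H) 0 0 = bz qq] &
  exists (th th' : {lrmorphism B -> Asub H}), forall a : Asub H,
  [/\ Phi (val a) 1 0 = 0, eps l * a = eps l * th (Phi (val a) 0 0)
    & eps (sw l) * a = eps (sw l) * th' (Phi (val a) 1 1)].
Proof.
have [Phi PhiZ [PhiT PhiU PhiV PhiS Phic]] := hl_Phi hyp l.
rewrite /psT /psU /psV /psS in PhiT PhiU PhiV PhiS Phic.
have PhiX : Phi (hX H) = mk2 (bx qq) (- (cl l)%:A * bz qq) 0 (by_ qq).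
  rewrite /hX rmorphM rmorphB /= PhiU PhiS Phic mk2_opp mk2_add mk2_mul.
  by have := bzi qq; set k := (cl l)%:A => e; congr mk2; ring: e.
have PhiY : Phi (hY H) = mk2 (by_ qq) ((cl l)%:A * bz qq) 0 (bx qq).
  rewrite /hY rmorphM /= PhiU PhiS mk2_mul.
  by have := bzi qq; set k := (cl l)%:A => e; congr mk2; ring: e.
have Phiz : Phi (hz H) = mk2 (bz qq) 0 0 (bz qq).
  by rewrite /hz rmorphXn PhiU expr2 mk2_mul; congr mk2; ring.
have PhizV : Phi (hzV H) = mk2 (bi qq) 0 0 (bi qq).
  by rewrite /hzV rmorphXn PhiV expr2 mk2_mul; congr mk2; ring.
exists Phi; first by rewrite PhiX PhiY Phiz !mk2E.
have [th [thx thy thz thi]] := theta_ex.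
have [th' [th'x th'y th'z th'i]] := theta'_ex.
exists th, th'; elim/subalg_ind=> [k|i|||||a b [a1 a2 a3] [b1 b2 b3]
    |a b [a1 a2 a3] [b1 b2 b3]].
- rewrite avalZ PhiZ rmorph1 mulr1 ps_scalarE !mk2E.
  by rewrite !linearZ !rmorph1.
- rewrite PhiT !mk2E !linearZ !rmorph1 /= !mulr_algr.
  by split=> //; rewrite hl_eps // hl_lam.
- by rewrite PhiX !mk2E thx th'y.
- by rewrite PhiY !mk2E thy th'x.
- by rewrite Phiz !mk2E thz th'z.
- by rewrite PhizV !mk2E thi th'i.
- rewrite avalD rmorphD /= !mxE a1 b1 addr0 !rmorphD /= !mulrDr.
  by rewrite a2 b2 a3 b3.
- rewrite avalM rmorphM !mul2E a1 b1 !(mulr0, mul0r, addr0, add0r) !rmorphM.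
  have mulCA (x y z : Asub H) : x * y * z = x * z * y.
    by rewrite -!mulrA (Asub_mulC y).
  by split=> //; rewrite !mulrA ?a2 ?a3 mulCA ?b2 ?b3 mulCA.
Qed.

(** In the lower left entry the triangular [a] contributes nothing and [b U] contributes the lower
    right entry of [b]. The series at [sw l] is taken because this entry then determines
    [eps l * b]. *)
Lemma hcoord_uniq0 (a b : Asub H) : val a + val b * U = 0 -> a = 0 /\ b = 0.
Proof.
move=> ab0; suff b0 : b = 0.
  by split=> //; apply: aval_inj; move: ab0; rewrite b0 aval0 mul0r addr0.
rewrite -[b]mul1r -(hl_sum hyp) mulr_suml big1 // => l _.
have [Phi [_ [PhiU _ _ _]] [th [th' thP]]] := Phi_triang (sw l).
have [a1 _ _] := thP a; have [b1 _] := thP b; rewrite hl_swK // => ->.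
have /(congr1 (fun M : 'M_2 => M 1 0)) : Phi (val a + val b * U) = 0.
  by rewrite ab0 rmorph0.
rewrite rmorphD rmorphM /= PhiU [LHS]mxE [RHS]mxE mul2E !mk2E b1 a1 mul0r mulr1 !add0r => ->.
by rewrite rmorph0 mulr0.
Qed.

(** The action on the eigenvector v. It carries non-zero-divisors of the component ring back to
    A. *)
Lemma chi_ex l : exists2 chi : {lrmorphism Asub H -> B},
  [/\ chi (aX H) = bx qq, chi (aY H) = by_ qq & chi (az H) = bz qq] &
  forall a, chi a = 0 -> eps l * a = 0.
Proof.
have [Phi [PhiZ [PhiU PhiX PhiY Phiz]] [th [th' thP]]] := Phi_triang l.
pose chi (a : Asub H) := Phi (val a) 0 0.
have chiB : zmod_morphism chi.
  by move=> a b; rewrite /chi avalD rmorphD rmorphN !mxE.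
have chi1 : chi 1 = 1 by rewrite /chi rmorph1 mk2_one mk2E.
have chiM : {morph chi : a b / a * b}.
  move=> a b; rewrite /chi avalM rmorphM mul2E.
  by have [-> _ _] := thP b; rewrite mulr0 addr0.
pose fa := GRing.isZmodMorphism.Build _ _ chi chiB.
pose fm := GRing.isMonoidMorphism.Build _ _ chi (conj chi1 chiM).
have chiZ : scalable chi.
  move=> k a; rewrite /chi avalZ PhiZ ps_scalarE mul2E !mk2E mul0r addr0.
  by rewrite mulr_algl.
pose fs := GRing.isScalable.Build _ _ _ _ chi chiZ.
exists (HB.pack chi fa fm fs : {lrmorphism Asub H -> B}) => //= a.
by have [_ -> _] := thP a; rewrite /chi => ->; rewrite rmorph0 mulr0.
Qed.

Lemma Asub_eq0 a : (forall l, eps l * a = 0) -> a = 0.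
Proof.
by move=> a0; rewrite -[a]mul1r -(hl_sum hyp) mulr_suml big1.
Qed.

Lemma nzd_YX a : (aY H - aX H) * a = 0 -> a = 0.
Proof.
move=> a0; apply: Asub_eq0 => l; have [chi [chiX chiY _]] := chi_ex l; apply.
apply: (@bxBy_nzd _ qq); apply: oppr_inj; rewrite -mulNr opprB oppr0.
by rewrite -chiX -chiY -rmorphB -rmorphM a0 rmorph0.
Qed.

Lemma nzd_zX2 a : (az H - aX H ^+ 2) * a = 0 -> a = 0.
Proof.
move=> a0; apply: Asub_eq0 => l; have [chi [chiX _ chiz]] := chi_ex l; apply.
apply: (@bzBx2_nzd _ qq).
by rewrite -chiX -chiz -rmorphXn -rmorphB -rmorphM a0 rmorph0.
Qed.

Lemma nzd_Y : (forall p : groupRing K int, qq *: p = 0 -> p = 0) ->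
  forall a, aY H * a = 0 -> a = 0.
Proof.
move=> qreg a a0; apply: Asub_eq0 => l; have [chi [_ chiY _]] := chi_ex l; apply.
by apply: (by_nzd qreg); rewrite -chiY -rmorphM a0 rmorph0.
Qed.

Definition hcoord h : Asub H * Asub H := projT1 (cid (hcoord_ex h)).

Lemma hcoordP h : h = val (hcoord h).1 + val (hcoord h).2 * U.
Proof. exact: (projT2 (cid (hcoord_ex h))). Qed.

Lemma hcoordE a b : hcoord (val a + val b * U) = (a, b).
Proof.
have := hcoordP (val a + val b * U); case: (hcoord _) => a' b' /= e.
have [] := @hcoord_uniq0 (a - a') (b - b').
  by rewrite !(avalD, avalN) mulrDl mulNr addrACA -opprD e subrr.
by move=> /subr0_eq-> /subr0_eq->.
Qed.

Definition aswap (a : Asub H) := (hcoord (U * val a)).2.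
Definition arest (a : Asub H) := (hcoord (U * val a)).1.

Lemma hU_mul a : U * val a = val (arest a) + val (aswap a) * U.
Proof. exact: hcoordP. Qed.

Lemma aswap_arestE a a' r :
  U * val a = val r + val a' * U -> aswap a = a' /\ arest a = r.
Proof. by move=> e; rewrite /aswap /arest e hcoordE. Qed.

End Characters.

(** * The representation *)

Section Representation.
Variables (K : comNzRingType) (H : heckeData K) (qq : K) (Lam : finType).
Variables (lam : Lam -> hidx H -> K) (sw : Lam -> Lam) (cl : Lam -> K).
Variables (eps : Lam -> Asub H) (aC : Asub H).
Local Notation B := (compRing qq).
Local Notation T := (@hT K H).
Local Notation S := (hS H).
Local Notation U := (hU H).
Local Notation V := (hV H).
Local Notation c := (hc H).
Local Notation sT := (@hswap K H).
Hypothesis hyp : hecke_like qq lam sw cl eps aC.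
Local Notation aswap := (aswap hyp).
Local Notation arest := (arest hyp).
Local Notation hcoord := (hcoord hyp).
Local Notation mulC := (Asub_mulC hyp).

Lemma mulCA (a b d : Asub H) : a * (b * d) = b * (a * d).
Proof. by rewrite mulrA (mulC a) -mulrA. Qed.

Lemma aswap_arestD a b :
  aswap (a + b) = aswap a + aswap b /\ arest (a + b) = arest a + arest b.
Proof.
apply: aswap_arestE; rewrite !avalD mulrDr !(hU_mul hyp) mulrDl.
by rewrite addrACA.
Qed.

Lemma aswap_arestM a b : aswap (a * b) = aswap a * aswap b /\
  arest (a * b) = arest a * b + aswap a * arest b.
Proof.
apply: aswap_arestE; rewrite !(avalD, avalM) mulrA (hU_mul hyp a) mulrDl.
by rewrite -[_ * U * _]mulrA (hU_mul hyp b) mulrDr !mulrA addrA.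
Qed.

Lemma aswap_arestZ k a : aswap (k *: a) = k *: aswap a /\ arest (k *: a) = k *: arest a.
Proof.
by apply: aswap_arestE; rewrite !avalZ -scalerAr (hU_mul hyp) scalerDr -scalerAl.
Qed.

Lemma aswap_arest1 : aswap 1 = 1 /\ arest 1 = 0.
Proof. by apply: aswap_arestE; rewrite aval1 aval0 mulr1 mul1r add0r. Qed.

Lemma aswap_arestT i : aswap (aT i) = aT (sT i) /\ arest (aT i) = 0.
Proof. by apply: aswap_arestE; rewrite aval0 add0r; apply: (hl_UT hyp). Qed.

Lemma aswap_arestX : aswap (aX H) = aY H /\ arest (aX H) = - (az H * aC).
Proof.
apply: aswap_arestE; rewrite avalN avalM (aC_val hyp) addrC.
rewrite -[LHS]/(U * (U * (S - c))) mulrA -expr2 -/(hz H) mulrBr; congr (_ - _).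
rewrite {1}(hS_E hyp) (hz_central hyp) -mulrA -(hz_central hyp) mulrA.
by rewrite -[_ * _ * hz H]mulrA (hzV_hz hyp) mulr1.
Qed.

Lemma aswap_arestY : aswap (aY H) = aX H /\ arest (aY H) = az H * aC.
Proof.
apply: aswap_arestE; rewrite avalM (aC_val hyp).
rewrite -[LHS]/(U * (S * U)) mulrA (hUS_E hyp) mulrDl addrC; congr (_ + _).
by rewrite -mulrA -expr2 -/(hz H) (hz_central hyp).
Qed.

Lemma aswap_arestz : aswap (az H) = az H /\ arest (az H) = 0.
Proof. by apply: aswap_arestE; rewrite aval0 add0r -(hz_central hyp). Qed.

Lemma aswap_arestzV : aswap (azV H) = azV H /\ arest (azV H) = 0.
Proof. by apply: aswap_arestE; rewrite aval0 add0r -(hzV_central hyp). Qed.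

Lemma aswapD a b : aswap (a + b) = aswap a + aswap b.
Proof. by have [] := aswap_arestD a b. Qed.

Lemma aswapM a b : aswap (a * b) = aswap a * aswap b.
Proof. by have [] := aswap_arestM a b. Qed.

Lemma aswapZ k a : aswap (k *: a) = k *: aswap a.
Proof. by have [] := aswap_arestZ k a. Qed.

Lemma aswap1 : aswap 1 = 1. Proof. by have [] := aswap_arest1. Qed.
Lemma aswapT i : aswap (aT i) = aT (sT i). Proof. by have [] := aswap_arestT i. Qed.
Lemma aswapX : aswap (aX H) = aY H. Proof. by have [] := aswap_arestX. Qed.
Lemma aswapY : aswap (aY H) = aX H. Proof. by have [] := aswap_arestY. Qed.
Lemma aswapz : aswap (az H) = az H. Proof. by have [] := aswap_arestz. Qed.
Lemma aswapzV : aswap (azV H) = azV H. Proof. by have [] := aswap_arestzV. Qed.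
Lemma arestX : arest (aX H) = - (az H * aC). Proof. by have [] := aswap_arestX. Qed.

Lemma aswapN a : aswap (- a) = - aswap a.
Proof. by rewrite -scaleN1r aswapZ scaleN1r. Qed.

Lemma aswapB a b : aswap (a - b) = aswap a - aswap b.
Proof. by rewrite aswapD aswapN. Qed.

Lemma aswap0 : aswap 0 = 0.
Proof. by rewrite -[X in aswap X](subrr 0) aswapB subrr. Qed.

Lemma is_swap_aswap (f : {lrmorphism Asub H -> Asub H}) : is_swap f -> f =1 aswap.
Proof.
move=> [fT fX fY fz]; elim/subalg_ind=> [k|i|||||a b ea eb|a b ea eb].
- by rewrite linearZ rmorph1 aswapZ aswap1.
- by rewrite fT aswapT.
- by rewrite fX aswapX.
- by rewrite fY aswapY.
- by rewrite fz aswapz.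
(* [is_swap] does not prescribe the value at z_2^-1; it is forced by that at z_2. *)
- have : f (azV H) * az H = 1 by rewrite -fz -rmorphM (azV_az hyp) rmorph1.
  rewrite aswapzV => /(congr1 (fun a => a * azV H)).
  by rewrite mul1r -mulrA (az_azV hyp) mulr1.
- by rewrite rmorphD /= ea eb aswapD.
- by rewrite rmorphM /= ea eb aswapM.
Qed.

Lemma aswap_lrmorphism : exists2 f : {lrmorphism Asub H -> Asub H}, is_swap f & f =1 aswap.
Proof.
pose fa := GRing.isZmodMorphism.Build _ _ aswap aswapB.
pose fm := GRing.isMonoidMorphism.Build _ _ aswap (conj aswap1 aswapM).
pose fs := GRing.isScalable.Build _ _ _ _ aswap aswapZ.
exists (HB.pack aswap fa fm fs : {lrmorphism Asub H -> Asub H}) => //.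
by split; rewrite /= ?aswapX ?aswapY ?aswapz // => i; rewrite aswapT.
Qed.

Lemma W0_invariantP a : W0_invariant a <-> aswap a = a.
Proof.
split=> [[f fswap fa]|aa]; first by rewrite -(is_swap_aswap fswap).
by have [f fswap fE] := aswap_lrmorphism; exists f; rewrite ?fE.
Qed.

(** Both sides satisfy the twisted Leibniz rule d(a b) = d(a) b + s(a) d(b), so generators suffice;
    for T_i this is c T_i = c T_(s i). *)
Lemma arest_divided a : (aY H - aX H) * arest a = az H * aC * (a - aswap a).
Proof.
elim/subalg_ind: a => [k|i|||||a b ea eb|a b ea eb].
- have [_ r1] := aswap_arest1; have [-> ->] := aswap_arestZ k 1.
  by rewrite r1 aswap1 scaler0 mulr0 subrr mulr0.
- have [-> ->] := aswap_arestT i; rewrite mulr0 -mulrA mulrBr.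
  rewrite (_ : aC * aT i = aC * aT (sT i)) ?subrr ?mulr0 //.
  by apply: aval_inj; rewrite !avalM (aC_val hyp); apply: (hl_cTT hyp).
- have [-> ->] := aswap_arestX.
  by rewrite mulrN -mulNr opprB [LHS]mulC.
- by have [-> ->] := aswap_arestY; rewrite [LHS]mulC.
- by have [-> ->] := aswap_arestz; rewrite mulr0 subrr mulr0.
- by have [-> ->] := aswap_arestzV; rewrite mulr0 subrr mulr0.
- by have [-> ->] := aswap_arestD a b; rewrite mulrDr ea eb -mulrDr opprD addrACA.
- have [-> ->] := aswap_arestM a b.
  rewrite mulrDr mulrA ea [_ * (aswap a * _)]mulCA eb [aswap a * _]mulCA -mulrA.
  by rewrite -mulrDr mulrBl mulrBr addrA subrK.
Qed.

(** For an invariant [a] the divided formula reads (Y - X) r(a) = 0, hence r(a) = 0 and [a] commutes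
    with U. *)
Lemma invariant_central a : aswap a = a -> central (val a).
Proof.
move=> aa; have ra : arest a = 0.
  by apply: (nzd_YX hyp); rewrite arest_divided aa subrr mulr0.
have aU : val a * U = U * val a by rewrite (hU_mul hyp) ra aa add0r.
move=> h; rewrite (hcoordP hyp h) mulrDr mulrDl mulrA -[X in _ = _ + X]mulrA -aU mulrA.
by rewrite -!avalM [a * _]mulC [a * _]mulC.
Qed.

Section Projection.
Variable u0 : Asub H.
Hypothesis hu0 : aswap u0 * u0 + arest u0 = az H.

(* The kernel of [proj], the image of [U - u0] under left multiplication by the
   commutative subalgebra, is a left ideal by [hu0]. *)
Definition proj h : Asub H := (hcoord h).1 + (hcoord h).2 * u0.

Definition hrep h (a : Asub H) : Asub H := proj (h * val a).

Lemma projE a b : proj (val a + val b * U) = a + b * u0.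
Proof. by rewrite /proj hcoordE. Qed.

Lemma proj_val a : proj (val a) = a.
Proof. by have := projE a 0; rewrite aval0 !mul0r !addr0. Qed.

Lemma projD h h' : proj (h + h') = proj h + proj h'.
Proof.
rewrite {1}(hcoordP hyp h) {1}(hcoordP hyp h') addrACA -mulrDl -!avalD projE.
by rewrite mulrDl addrACA.
Qed.

Lemma projA a h : proj (val a * h) = a * proj h.
Proof.
by rewrite {1}(hcoordP hyp h) mulrDr mulrA -!avalM projE mulrDr mulrA.
Qed.

Lemma projZ k h : proj (k *: h) = k *: proj h.
Proof.
by rewrite -[h]mul1r scalerAl -aval1 -avalZ projA -scalerAl mul1r aval1 mul1r.
Qed.

Lemma projU a : proj (U * val a) = aswap a * u0 + arest a.
Proof. by rewrite (hU_mul hyp) projE addrC. Qed.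

Lemma proj_mul g h : proj (g * h) = proj (g * val (proj h)).
Proof.
(* As [proj] is A-linear, g = U is the only case to check; [hu0] is what turns U U = z_2 into the
   action of U on [u0]. *)
have PU : proj (U * h) = proj (U * val (proj h)).
  rewrite {1}(hcoordP hyp h) projU /proj; case: (hcoord h) => x y /=.
  have -> : U * (val x + val y * U) =
      val (arest x + aswap y * az H) + val (aswap x + arest y) * U.
    rewrite mulrDr mulrA !(hU_mul hyp) !(avalD, avalM) !mulrDl -[_ * U * U]mulrA.
    by rewrite -expr2 -!addrA; congr (_ + _); rewrite [RHS]addrC -addrA.
  rewrite hcoordE /= aswapD aswapM; have [_ ->] := aswap_arestD x (y * u0).
  have [_ ->] := aswap_arestM y u0; rewrite -hu0 !mulrDl mulrDr !mulrA.
  by rewrite [LHS](AC (1*2*2) ((4*2)*(1*(5*3)))).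
have E x y k : proj ((val x + val y * U) * k) = x * proj k + y * proj (U * k).
  by rewrite mulrDl projD projA -mulrA projA.
by rewrite (hcoordP hyp g) !E PU proj_val.
Qed.

Lemma hrep_rep : faithful_rep hrep -> hecke_rep hrep.
Proof.
move=> inj.
have hrepM h h' a : hrep (h * h') a = hrep h (hrep h' a).
  by rewrite /hrep -mulrA proj_mul.
have hrepA a b : hrep (val a) b = a * b by rewrite /hrep projA proj_val.
have hrepDr h a b : hrep h (a + b) = hrep h a + hrep h b.
  by rewrite /hrep avalD mulrDr projD.
split=> [h|h h' a|//|a|k h a].
- split=> // z zC a b ab.
  have eb : hrep z a = b.
    by rewrite -[RHS]proj_val ab.
  have zA : z = val (hrep z 1).
    apply: inj => a'; rewrite hrepA -[LHS]/(proj _) zC projA [RHS]mulC.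
    by rewrite /hrep aval1 mulr1.
  by rewrite -eb -hrepM -zC hrepM {1}zA hrepA avalM -zA.
- by rewrite /hrep mulrDl projD.
- by rewrite -[1]aval1 hrepA mul1r.
- by rewrite /hrep -scalerAl projZ.
Qed.

Lemma hrep_extends_mul : extends_mul hrep.
Proof. by move=> a b; rewrite /hrep projA proj_val. Qed.

Lemma hrepS a : hrep S a = azV H * aY H * (aswap a * u0 + arest a).
Proof.
rewrite -projU -projA avalM /hrep {1}(hS_E hyp) -(hzV_central hyp) !mulrA.
by [].
Qed.

(** If a + b U acts by zero, its value at 1 gives a = - b u0, and its value at f is then [b] times
    the displayed factor. *)
Lemma hrep_inj : (forall b, (forall f, b * (aswap f * u0 + arest f - f * u0) = 0) -> b = 0) ->
  faithful_rep hrep.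
Proof.
move=> u0P h h' hh'.
have e0 : h - h' = 0; last by apply/eqP; rewrite -subr_eq0 e0.
have hE (f : Asub H) : proj ((h - h') * val f) = 0.
  rewrite mulrDl projD mulNr -scaleN1r projZ scaleN1r.
  by rewrite -/(hrep h f) -/(hrep h' f) hh' subrr.
move: (h - h') hE => g hE; rewrite (hcoordP hyp g).
case: (hcoord g) (hcoordP hyp g) => a b /= gE.
have ea : a = - (b * u0).
  by apply/eqP; rewrite -addr_eq0 -(projE a b) -gE -[g]mulr1 -aval1 hE.
have eb : b = 0.
  apply: u0P => f; have := hE f.
  rewrite gE mulrDl projD projA proj_val -mulrA projA projU ea mulNr => <-.
  by rewrite mulrBr addrC -mulrA [u0 * f]mulC.
by rewrite ea eb mul0r oppr0 aval0 add0r mul0r.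
Qed.

(** * The Demazure operator on a non-regular component *)

Section Demazure.
Variable e : Asub H.
Hypothesis se : aswap e = e.
Hypothesis eT : forall i, e * aT i = e * aT (sT i).
Hypotheses (eC : aC * e = (qq - 1) *: e) (eu0 : e * u0 = e * aX H).

(** The factor [e] takes care of the T_i, where it annihilates T_i - T_(s i) by [eT]; products
    follow from the twisted Leibniz rule. *)
Lemma divided_difference a : exists g, e * (a - aswap a) = (aY H - aX H) * g.
Proof.
elim/subalg_ind: a => [k|i|||||a b [g ea] [g' eb]|a b [g ea] [g' eb]].
- by exists 0; rewrite aswapZ aswap1 subrr !mulr0.
- by exists 0; rewrite aswapT mulrBr eT subrr mulr0.
- by exists (- e); rewrite aswapX mulrN -mulNr opprB mulC.
- by exists e; rewrite aswapY mulC.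
- by exists 0; rewrite aswapz subrr !mulr0.
- by exists 0; rewrite aswapzV subrr !mulr0.
- by exists (g + g'); rewrite aswapD opprD addrACA !mulrDr -ea -eb !mulrDr.
- exists (g * b + aswap a * g'); rewrite aswapM [RHS]mulrDr mulrA -ea.
  rewrite [_ * (aswap a * _)]mulCA -eb [aswap a * (e * _)]mulCA -mulrA -mulrDr.
  by congr (_ * _); rewrite mulrBl mulrBr addrA subrK.
Qed.

Definition ddiff a : Asub H := projT1 (cid (divided_difference a)).

Lemma ddiffP a : e * (a - aswap a) = (aY H - aX H) * ddiff a.
Proof. exact: (projT2 (cid (divided_difference a))). Qed.

Lemma ddiff_uniq a g : e * (a - aswap a) = (aY H - aX H) * g -> ddiff a = g.
Proof.
move=> ag; apply/eqP; rewrite -subr_eq0; apply/eqP/(nzd_YX hyp).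
by rewrite mulrBr -ddiffP ag subrr.
Qed.

(** In S a = z_2^-1 Y (s(a) X + r(a)), the first term is q s(a) because X Y = q z_2, and r(a) is (q
    - 1) z_2 times the divided difference. *)
Lemma hrepS_ddiff a : e * a = a ->
  hrep S a = qq *: aswap a + (qq - 1) *: (aY H * ddiff a).
Proof.
move=> ea; have esa : e * aswap a = aswap a by rewrite -[in RHS]ea aswapM se.
rewrite hrepS.
have -> : arest a = (qq - 1) *: (az H * ddiff a).
  apply/eqP; rewrite -subr_eq0; apply/eqP/(nzd_YX hyp).
  rewrite mulrBr arest_divided -scalerAr mulCA -ddiffP -{1}ea -{1}esa -mulrBr.
  by rewrite -mulrA [aC * _]mulrA eC -scalerAl -scalerAr subrr.
have -> : aswap a * u0 = aswap a * aX H.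
  by rewrite -esa -!mulrA [e * _]mulCA eu0 mulCA.
rewrite mulrDr -!scalerAr -!mulrA [aY H * (aswap a * _)]mulCA.
rewrite [aY H * (az H * _)]mulCA [aY H * aX H]mulC (aXY hyp).
rewrite [azV H * (aswap a * _)]mulCA -!scalerAr (azV_az hyp) mulr1.
by rewrite [azV H * _]mulrA (azV_az hyp) mul1r.
Qed.

Lemma hrep_demazure : demazure_on qq e (hrep S).
Proof.
(* For invariant b the divided difference is 0 at b, b at b Y and -b at b X, which makes these the
   two projectors. Substituting s(a) = a - (Y - X) [ddiff a] in the formula for S then gives minus
   their combination. *)
exists (fun a => aY H * ddiff a), (fun a => a + aX H * ddiff a); split.
- move=> m n [b [/W0_invariantP sb eb] ->] [/W0_invariantP sn en].
  rewrite (@ddiff_uniq _ b); first exact: mulC.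
  rewrite aswapD aswapM aswapY sb sn.
  by rewrite opprD addrACA subrr addr0 -mulrBr mulrA eb mulC.
- move=> m n [/W0_invariantP sm em] [b [/W0_invariantP sb eb] ->].
  rewrite (@ddiff_uniq _ (- b)); first by rewrite mulrN [aX H * _]mulC addrK.
  rewrite aswapD aswapM aswapX sb sm.
  rewrite opprD addrACA subrr add0r -mulrBr mulrA eb mulrN -mulNr opprB.
  exact: mulC.
move=> a ea; rewrite hrepS_ddiff // scalerDr scalerBl scale1r.
have esa : e * aswap a = aswap a by rewrite -[in RHS]ea aswapM se.
have -> : aswap a = a - (aY H - aX H) * ddiff a.
  by rewrite -ddiffP mulrBr ea esa opprB addrC subrK.
by rewrite mulrBl !scalerBr !opprB !addrA subrK.
Qed.

End Demazure.

(** The projectors in [demazure_on] are existentially quantified; uniqueness needs only this value,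
    where D vanishes and D' is the identity. *)
Lemma demazure_on_idem e f : e * e = e -> aswap e = e -> demazure_on qq e f ->
  f e = qq *: e.
Proof.
move=> ee se [D [D' [DP D'P fP]]].
have inve : comp_invariant e e by split=> //; apply/W0_invariantP.
have inv0 : comp_invariant e 0.
  by split; [apply/W0_invariantP; rewrite aswap0 | rewrite mulr0].
have D0 : D e = 0.
  by have := DP 0 e; rewrite add0r; apply=> //; exists 0; rewrite ?mul0r.
have D1 : D' e = e.
  by have := D'P e 0; rewrite addr0; apply=> //; exists 0; rewrite ?mul0r.
by rewrite fP // D0 D1 sub0r opprK.
Qed.

(** The two conditions on [u0] amount to U e1 = e2 and U e2 = z_2 e1; applying S = z_2^-1 Y U gives
    the prescribed values. *)
Lemma hrep_vigneras e1 e2 : aswap e1 = e2 -> aswap e2 = e1 ->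
  arest e1 = 0 -> arest e2 = 0 -> e1 * e1 = e1 -> e2 * e2 = e2 -> e1 * e2 = 0 ->
  e1 * u0 = az H * e1 -> e2 * u0 = e2 -> vigneras_on e1 e2 (hrep S).
Proof.
move=> s1 s2 r1 r2 e11 e22 e12 u1 u2; split.
- move=> d a [/W0_invariantP sd _] _.
  by rewrite /hrep avalM mulrA -(invariant_central sd) -mulrA projA.
- by move=> a b _ _; rewrite /hrep avalD mulrDr projD.
- rewrite hrepS s1 r1 addr0 u2 -!mulrA; congr (_ * _).
  by rewrite mulrDl -!mulrA e12 mulr0 add0r e22.
- rewrite hrepS s2 r2 addr0 u1 mulrDl -!mulrA e11 [e2 * _]mulC e12 mulr0 addr0.
  by rewrite mulCA [azV H * _]mulrA (azV_az hyp) mul1r.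
Qed.

(** Since rho(h)(a) = rho(h a)(1) and h a lies in A + A U, everything depends on rho(U)(1). It is
    recovered from rho(S)(1) = Y z_2^-1 rho(U)(1) by cancelling Y. *)
Lemma hrep_uniq rho : (forall p : groupRing K int, qq *: p = 0 -> p = 0) ->
  hecke_rep rho -> extends_mul rho -> rho S 1 = hrep S 1 ->
  forall h, rho h =1 hrep h.
Proof.
move=> qreg [_ rhoD rhoM rho1 _] rhoA rhoS.
have rhoE (a b : Asub H) : rho (val a + val b * U) 1 = a + b * rho U 1.
  by rewrite rhoD rhoM !rhoA mulr1.
have rhoU : rho U 1 = u0.
  apply/eqP; rewrite -subr_eq0; apply/eqP.
  have : aY H * (azV H * (rho U 1 - u0)) = 0.
    apply/eqP; rewrite !mulrBr subr_eq0; apply/eqP.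
    have := rhoS; rewrite {1}(hS_E hyp) -[hY H * _ * _]add0r -aval0.
    rewrite -[hY H * _]/(val (aY H * azV H)) rhoE add0r -mulrA => ->.
    rewrite hrepS; have [-> ->] := aswap_arest1.
    by rewrite mul1r addr0 -mulrA mulCA.
  move/(nzd_Y hyp qreg)/(congr1 (fun a => az H * a)).
  by rewrite mulr0 mulrA (az_azV hyp) mul1r.
move=> h a; rewrite -[a in LHS]mulr1 -rhoA -rhoM /hrep (hcoordP hyp (h * val a)).
by rewrite rhoE rhoU projE.
Qed.

End Projection.
End Representation.

(** * Compatibility with base change and with an idempotent component *)

Section Comparison.
Variables (K1 K2 : comNzRingType) (H1 : heckeData K1) (H2 : heckeData K2).
Variables (q1 : K1) (q2 : K2) (L1 L2 : finType).
Variables (lam1 : L1 -> hidx H1 -> K1) (sw1 : L1 -> L1) (cl1 : L1 -> K1).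
Variables (lam2 : L2 -> hidx H2 -> K2) (sw2 : L2 -> L2) (cl2 : L2 -> K2).
Variables (eps1 : L1 -> Asub H1) (aC1 : Asub H1).
Variables (eps2 : L2 -> Asub H2) (aC2 : Asub H2).
Hypothesis hyp1 : hecke_like q1 lam1 sw1 cl1 eps1 aC1.
Hypothesis hyp2 : hecke_like q2 lam2 sw2 cl2 eps2 aC2.
Variables (phi : K1 -> K2) (beta : H1 -> H2) (e u2 : Asub H2).
Hypothesis betaD : forall x y, beta (x + y) = beta x + beta y.
Hypothesis betaM : forall x y, beta (x * y) = beta x * beta y.
Hypothesis betaZ : forall k x, beta (k *: x) = phi k *: beta x.
Hypothesis beta1 : beta 1 = val e.
Hypothesis betaS : beta (hS H1) = hS H2 * val e.
Hypothesis betaU : beta (hU H1) = hU H2 * val e.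
Hypothesis betac : beta (hc H1) = hc H2 * val e.
Hypothesis betaT : forall i, exists a : Asub H2, val a = beta (hT i).
Hypothesis eU : val e * hU H2 = hU H2 * val e.
Hypothesis eu2 : e * u2 = e * aX H2.

Lemma beta_unitl x : val e * beta x = beta x.
Proof. by rewrite -beta1 -betaM mul1r. Qed.

Lemma beta_unitr x : beta x * val e = beta x.
Proof. by rewrite -beta1 -betaM mulr1. Qed.

Lemma beta_V : beta (hV H1) = hV H2 * val e.
Proof.
rewrite -[LHS]beta_unitl -[LHS]mul1r -(hl_VU hyp2) -!mulrA; congr (_ * _).
by rewrite mulrA -betaU -betaM (hl_UV hyp1) beta1.
Qed.

Lemma beta_opp x : beta (- x) = - beta x.
Proof.
apply/eqP; rewrite -addr_eq0 -betaD addNr.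
by rewrite -(addrK (beta 0) (beta 0)) -betaD addr0 subrr.
Qed.

Lemma beta_X : beta (hX H1) = hX H2 * val e.
Proof.
rewrite /hX betaM betaU -mulrA beta_unitl betaD beta_opp betaS betac.
by rewrite -mulrBl mulrA.
Qed.

Lemma beta_Asub (a : Asub H1) : exists a' : Asub H2, val a' = beta (val a).
Proof.
have UM x : hU H2 * beta x = beta (hU H1) * beta x by rewrite betaU -mulrA beta_unitl.
have SM x : hS H2 * beta x = beta (hS H1) * beta x by rewrite betaS -mulrA beta_unitl.
have VM x : hV H2 * beta x = beta (hV H1) * beta x by rewrite beta_V -mulrA beta_unitl.
elim/subalg_ind: a => [k|i|||||a b [a' ea] [b' eb]|a b [a' ea] [b' eb]].
- by exists (phi k *: e); rewrite avalZ betaZ beta1.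
- by have [a ea] := betaT i; exists a.
- by exists (aX H2 * e); rewrite avalM -[RHS]/(beta (hX H1)) beta_X.
- exists (aY H2 * e); rewrite avalM -[val (aY H1)]/(hS H1 * hU H1).
  by rewrite betaM -SM -[val (aY H2)]/(hS H2 * hU H2) betaU mulrA.
- exists (az H2 * e); rewrite avalM -[val (az H1)]/(hU H1 ^+ 2) expr2.
  by rewrite betaM -UM -[val (az H2)]/(hU H2 ^+ 2) betaU mulrA expr2.
- exists (azV H2 * e); rewrite avalM -[val (azV H1)]/(hV H1 ^+ 2) expr2.
  by rewrite betaM -VM -[val (azV H2)]/(hV H2 ^+ 2) beta_V mulrA expr2.
- by exists (a' + b'); rewrite !avalD ea eb betaD.
- by exists (a' * b'); rewrite !avalM ea eb betaM.
Qed.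

(** [beta] is multiplicative with unit [e], which covers both a base change (e = 1) and the
    embedding of a component. Both actions are read off from A + A U, with U acting on 1 by X in the
    source and by [u2] in the target; these agree after multiplication by [e]. *)
Lemma beta_hrep h a : exists2 a' : Asub H2, val a' = beta (val a) &
  val (hrep hyp2 u2 (beta h) a') = beta (val (hrep hyp1 (aX H1) h a)).
Proof.
have betaX : beta (val (aX H1)) = val (e * u2).
  by rewrite eu2 (Asub_mulC hyp2) avalM; apply: beta_X.
have [a' ea] := beta_Asub a; exists a' => //; rewrite /hrep ea -betaM.
have [x [y ->]] : exists x y : Asub H1, h * val a = val x + val y * hU H1.
  by exists (hcoord hyp1 (h * val a)).1, (hcoord hyp1 (h * val a)).2; apply: hcoordP.
have [[x' ex] [y' ey]] := (beta_Asub x, beta_Asub y).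
rewrite betaD betaM betaU -eU mulrA beta_unitr -ex -ey. rewrite !projE.
rewrite !(avalD, avalM) betaD betaM betaX -ex -ey avalM mulrA.
by congr (_ + _ * _); rewrite ey beta_unitr.
Qed.

End Comparison.

(** * The Iwahori-Hecke algebra as an instance of the interface *)

Section IwahoriModel.
Variables (K : comNzRingType) (qq : K).
Local Notation H := (iwahori qq).

Definition iwahori_lam (_ : unit) (i : hidx H) : K := of_void K i.
Definition iwahori_eps (_ : unit) : Asub H := 1.
Definition iwahori_aC : Asub H := (qq - 1) *: 1.

Lemma iwahori_UV_eq : hU H * hV H = 1.
Proof.
rewrite -[LHS]pres_classM (pres_class_rel (P := iwahori_pres qq) (iwahori_UV qq)).
by rewrite pres_classC scale1r.
Qed.

Lemma iwahori_VU_eq : hV H * hU H = 1.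
Proof.
rewrite -[LHS]pres_classM (pres_class_rel (P := iwahori_pres qq) (iwahori_VU qq)).
by rewrite pres_classC scale1r.
Qed.

Lemma iwahori_UUS_eq : hU H * hU H * hS H = hS H * (hU H * hU H).
Proof.
by have := pres_class_rel (P := iwahori_pres qq) (iwahori_UUS qq); rewrite !pres_classM.
Qed.

Lemma iwahori_SS_eq : hS H * hS H = qq%:A + hc H * hS H.
Proof.
rewrite -[LHS]pres_classM (pres_class_rel (P := iwahori_pres qq) (iwahori_SS qq)).
by rewrite pres_classD pres_classM !pres_classC.
Qed.

Lemma iwahori_ind (Q : H -> Prop) : (forall k, Q (k *: 1)) ->
  Q (hS H) -> Q (hU H) -> Q (hV H) -> (forall x y, Q x -> Q y -> Q (x + y)) ->
  (forall x y, Q x -> Q y -> Q (x * y)) -> forall h, Q h.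
Proof.
move=> Qk QS QU QV QD QM.
by elim/presAlg_ind => [k|[]|x y|x y]; [apply: Qk | | | | apply: QD | apply: QM].
Qed.

Lemma iwahori_lift (L : nzRingType) (phi : {rmorphism K -> L}) (s u v : L) :
  (forall k y, phi k * y = y * phi k) -> u * v = 1 -> v * u = 1 ->
  u * u * s = s * (u * u) -> s * s = phi qq + phi (qq - 1) * s ->
  exists f : {rmorphism H -> L}, (forall k h, f (k *: h) = phi k * f h) /\
   [/\ f (hS H) = s, f (hU H) = u & f (hV H) = v].
Proof.
move=> phiC uv vu uus ss.
pose g i := match i with IS => s | IU => u | IV => v end.
have [|f [fZ fg]] := @presAlg_lift K _ (iwahori_pres qq) L phi g phiC.
  by move=> x y [] /=; rewrite ?rmorph1.
by exists f; split=> //; split; apply: fg.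
Qed.

Lemma iwahori_hecke_like :
  @hecke_like K H qq unit iwahori_lam id (fun=> qq - 1) iwahori_eps iwahori_aC.
Proof.
have cE h : hc H * h = (qq - 1) *: h by rewrite /= -scalerAl mul1r.
have Ec h : h * hc H = (qq - 1) *: h by rewrite /= -scalerAr mulr1.
split=> //; try by case.
- exact: iwahori_UV_eq.
- exact: iwahori_VU_eq.
- exact: iwahori_UUS_eq.
- exact: iwahori_SS_eq.
- by rewrite cE Ec.
- by rewrite cE Ec.
- by move=> Q *; apply: iwahori_ind.
- by rewrite big_const card_unit /= addr0.
case.
have [||||Phi [PhiZ [PhiS PhiU PhiV]]] := @iwahori_lift _ (ps_scalar qq)
    (psS qq (qq - 1)) (psU qq) (psV qq) (@ps_scalarC _ _).
- exact: psUV.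
- exact: psVU.
- exact: psUUS.
- by rewrite psSS -ps_scalarE.
by exists Phi => //; split=> //; rewrite PhiZ rmorph1 mulr1 ps_scalarE.
Qed.

End IwahoriModel.

(** * Characters of the torus *)

Section TorusCharacters.
Variable F : finFieldType.
Local Notation G := [set: {unit F}]%G.
Local Notation qm1 := (#|F|.-1).
Local Notation Zt := (Zt F).
Local Notation chi := {ffun torus F -> Zt}.

Lemma Zt_val_inj : injective (val : Zt -> algC).
Proof. exact: val_inj. Qed.

Lemma Zt_mulf_eq0 (x y : Zt) : x * y = 0 -> x != 0 -> y = 0.
Proof.
move=> xy x0; apply: Zt_val_inj; apply/eqP.
have /eqP : val x * val y = 0 by rewrite -[LHS]/(val (x * y)) xy.
rewrite mulf_eq0 => /orP[/eqP vx|//].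
by case/eqP: x0; apply: Zt_val_inj; rewrite vx.
Qed.

Lemma qm1_gt0 : (0 < qm1)%N.
Proof. by rewrite -card_finField_unit; apply/card_gt0P; exists 1%g; rewrite inE. Qed.

Lemma inv_qm1K : inv_qm1 F * qm1%:R = 1.
Proof.
apply: Zt_val_inj; rewrite rmorphM rmorph_nat rmorph1 /= mulVf //.
by rewrite pnatr_eq0 -lt0n qm1_gt0.
Qed.

Lemma unit_abelian : abelian G.
Proof. by apply/centsP=> x _ y _; apply: val_inj; rewrite /= mulrC. Qed.

Lemma unit_lin_char (i : Iirr G) : 'chi_i \is a linear_char.
Proof. exact: (char_abelianP _ unit_abelian). Qed.

(** An irreducible character of an abelian group of order q - 1 is linear, so its values are (q -
    1)-th roots of unity. *)
Lemma unit_char_root (i : Iirr G) (a : {unit F}) : in_Zt F ('chi_i a).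
Proof.
apply: in_Zt_root; rewrite -card_finField_unit -lin_charX ?unit_lin_char ?inE //.
by rewrite expg_cardG ?inE // lin_char1 ?unit_lin_char.
Qed.

Definition uchar (i : Iirr G) (a : {unit F}) : Zt :=
  exist _ ('chi_i a) (introT (asboolP _) (unit_char_root i a)).

Lemma uchar1 i : uchar i 1%g = 1.
Proof. by apply: Zt_val_inj; rewrite /= lin_char1 ?unit_lin_char. Qed.

Lemma ucharM i a b : uchar i (a * b)%g = uchar i a * uchar i b.
Proof. by apply: Zt_val_inj; rewrite /= lin_charM ?unit_lin_char ?inE. Qed.

(** Second orthogonality against the identity, whose centralizer is everything. This is what makes
    the idempotents [eps] sum to 1. *)
Lemma uchar_sum a : \sum_i uchar i a = qm1%:R *+ (a == 1%g).
Proof.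
apply: Zt_val_inj; rewrite rmorphMn rmorph_nat raddf_sum /=.
have := @second_orthogonality_relation _ G a 1%g (group1 _).
rewrite class1G inE.
have /setIidPl -> : G \subset 'C[a]%g.
  by apply/subsetP=> b _; apply/cent1P; apply: (centsP unit_abelian); rewrite inE.
rewrite card_finField_unit => <-; apply: eq_bigr => i _.
by rewrite lin_char1 ?unit_lin_char // conjC1 mulr1.
Qed.

Definition tchar (p : Iirr G * Iirr G) : chi :=
  [ffun t => uchar p.1 t.1 * uchar p.2 t.2].

Lemma tchar_is_char p : is_char (tchar p).
Proof.
split=> [|t u]; first by rewrite ffunE !uchar1 mulr1.
by rewrite !ffunE !ucharM mulrACA.
Qed.

Lemma tchar_swap p : char_swap (tchar p) = tchar (p.2, p.1).
Proof. by apply/ffunP=> t; rewrite !ffunE /= mulrC. Qed.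

Lemma tchar_sum t : \sum_p tchar p t = qm1%:R ^+ 2 *+ (t == 1%g).
Proof.
rewrite -(pair_bigA _ (fun i j => tchar (i, j) t)) /=.
have E i : \sum_j tchar (i, j) t = uchar i t.1 * \sum_j uchar j t.2.
  by rewrite mulr_sumr; apply: eq_bigr => j _; rewrite ffunE.
rewrite (eq_bigr _ (fun i _ => E i)).
rewrite -mulr_suml /= !uchar_sum; case: t {E} => a b /=.
have -> : ((a, b) == 1%g) = (a == 1%g) && (b == 1%g) by [].
by case: (a == _); case: (b == _); rewrite ?mulr1n ?mulr0n ?mul0r ?mulr0 ?expr2.
Qed.

Lemma is_charV (l : chi) t : is_char l -> l t * l t^-1%g = 1.
Proof. by move=> [l1 lM]; rewrite -lM mulgV. Qed.

(** Translation by [t0] multiplies the sum by [m t0], and [Zt] lies in a field. *)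
Lemma char_sum0 (m : torus F -> Zt) t0 :
  (forall t u, m (t * u)%g = m t * m u) -> m t0 != 1 -> \sum_t m t = 0.
Proof.
move=> mM m0; apply: (@Zt_mulf_eq0 (m t0 - 1)); last by rewrite subr_eq0.
rewrite mulrBl mul1r mulr_sumr; apply/eqP; rewrite subr_eq0; apply/eqP.
rewrite [RHS](reindex_inj (mulgI t0)) /=.
by apply: eq_bigr => t _; rewrite mM.
Qed.

Lemma torus_mulC (t u : torus F) : (t * u = u * t)%g.
Proof.
case: t u => a b [a' b']; have C x y := centsP unit_abelian x (in_setT x) y (in_setT y).
by congr pair; apply: C.
Qed.

Lemma char_orth (l l' : chi) : is_char l -> is_char l' -> l <> l' ->
  \sum_t l t^-1%g * l' t = 0.
Proof.
move=> [l1 lM] [l'1 l'M] ll'.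
have [t0 t0P] : exists t0, l t0 != l' t0.
  apply: contrapT => nex; apply: ll'; apply/ffunP=> t; apply/eqP.
  by apply: contrapT => /negP n; apply: nex; exists t.
apply: (@char_sum0 _ t0) => [t u|].
  by rewrite invMg [(u^-1 * _)%g]torus_mulC lM l'M mulrACA.
apply: contra t0P => /eqP /= e; apply/eqP.
by rewrite -[LHS]mulr1 -e mulrA -lM mulgV l1 mul1r.
Qed.

Lemma card_torus : #|{: torus F}| = (qm1 ^ 2)%N.
Proof.
have e : #|{: {unit F}}| = qm1 by rewrite -cardsT card_finField_unit.
by rewrite card_prod e expnS expn1.
Qed.

End TorusCharacters.

(** * The pro-p Iwahori-Hecke algebra *)

Section ProPIwahoriModel.
Variable F : finFieldType.
Local Notation K := {poly Zt F}.
Local Notation H := (hecke F).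
Local Notation P := (hecke_pres F).
Local Notation chi := {ffun torus F -> Zt F}.
Local Notation qm1 := (#|F|.-1).
Local Notation Lam := (Iirr [set: {unit F}] * Iirr [set: {unit F}])%type.

Definition pro_p_lam (p : Lam) (t : torus F) : K := (tchar p t)%:P.
Definition pro_p_sw (p : Lam) : Lam := (p.2, p.1).
Definition pro_p_cl (p : Lam) : K :=
  cs_coef F * \sum_(a : {unit F}) pro_p_lam p (a, a^-1)%g.
Definition pro_p_eps (p : Lam) : Asub H := eps (tchar p).
Definition pro_p_aC : Asub H :=
  cs_coef F *: \sum_(a : {unit F}) @aT K H (a, a^-1)%g.

Lemma hecke_rel_eq x y : hecke_rel x y -> pres_class P x = pres_class P y.
Proof. by move=> xy; apply: (pres_class_rel (P := P)). Qed.

Lemma hecke_TTE (t u : torus F) : @hT K H t * @hT K H u = @hT K H (t * u)%g.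
Proof. by have := hecke_rel_eq (hecke_TT t u); rewrite pres_classM. Qed.

Lemma hecke_T1E : @hT K H (1%g : torus F) = 1.
Proof. by have := hecke_rel_eq (hecke_T1 F); rewrite pres_classC scale1r. Qed.

Lemma hecke_STE t : hS H * @hT K H t = @hT K H (tswap t) * hS H.
Proof. by have := hecke_rel_eq (hecke_ST t); rewrite !pres_classM. Qed.

Lemma hecke_UTE t : hU H * @hT K H t = @hT K H (tswap t) * hU H.
Proof. by have := hecke_rel_eq (hecke_UT t); rewrite !pres_classM. Qed.

Lemma hecke_UVE : hU H * hV H = 1.
Proof. by have := hecke_rel_eq (hecke_UV F); rewrite pres_classM pres_classC scale1r. Qed.

Lemma hecke_VUE : hV H * hU H = 1.
Proof. by have := hecke_rel_eq (hecke_VU F); rewrite pres_classM pres_classC scale1r. Qed.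

Lemma hecke_UUSE : hU H * hU H * hS H = hS H * (hU H * hU H).
Proof. by have := hecke_rel_eq (hecke_UUS F); rewrite !pres_classM. Qed.

Lemma hecke_SSE : hS H * hS H = 'X%:A + hc H * hS H.
Proof.
have := hecke_rel_eq (hecke_SS F).
by rewrite pres_classM pres_classD pres_classC (pres_classM P (cs_expr F)).
Qed.

Lemma hecke_cE : hc H = cs_coef F *: \sum_(a : {unit F}) @hT K H (a, a^-1)%g.
Proof.
rewrite [LHS]pres_classM pres_classC mulr_algl; congr (_ *: _).
rewrite (big_morph (pres_class P) (op1 := +%R) (id1 := 0)) //.
exact: pres_classD.
Qed.

Lemma pro_p_aC_val : val pro_p_aC = hc H.
Proof. by rewrite hecke_cE avalZ raddf_sum. Qed.

Lemma hecke_ind (Q : H -> Prop) : (forall k, Q (k *: 1)) ->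
  (forall t, Q (@hT K H t)) -> Q (hS H) -> Q (hU H) -> Q (hV H) ->
  (forall x y, Q x -> Q y -> Q (x + y)) ->
  (forall x y, Q x -> Q y -> Q (x * y)) -> forall h, Q h.
Proof.
move=> Qk QT QS QU QV QD QM.
by elim/presAlg_ind => [k|[t|||]|x y|x y]; [apply: Qk | apply: QT | | | | apply: QD | apply: QM].
Qed.

Lemma hecke_lift (L : nzRingType) (phi : {rmorphism K -> L}) (T : torus F -> L)
    (s u v : L) :
  (forall k y, phi k * y = y * phi k) ->
  (forall t t', T t * T t' = T (t * t')%g) -> T 1%g = 1 ->
  (forall t, s * T t = T (tswap t) * s) -> (forall t, u * T t = T (tswap t) * u) ->
  u * v = 1 -> v * u = 1 -> u * u * s = s * (u * u) ->
  s * s = phi 'X + phi (cs_coef F) * (\sum_(a : {unit F}) T (a, a^-1)%g) * s ->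
  exists f : {rmorphism H -> L}, (forall k h, f (k *: h) = phi k * f h) /\
   [/\ forall t, f (@hT K H t) = T t, f (hS H) = s, f (hU H) = u & f (hV H) = v].
Proof.
move=> phiC TT T1 sT uT uv vu uus ss.
pose g i := match i with GT t => T t | GS => s | GU => u | GV => v end.
have [|f [fZ fg]] := @presAlg_lift K _ (hecke_pres F) L phi g phiC.
  move=> x y [] //=; rewrite ?rmorph1 //.
  rewrite (big_morph (nceval phi g) (op1 := +%R) (id1 := 0)) //=.
  by rewrite rmorph0.
by exists f; split=> //; split=> [t|||]; apply: fg.
Qed.

Lemma cs_coef_qm1 : cs_coef F * (#|F|.-1)%:R = 'X - 1.
Proof.
rewrite /cs_coef mulrAC -[X in _ * X * _]polyC_natr -polyCM.
by rewrite inv_qm1K mul1r.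
Qed.

(* If [f t <> f (tswap t)] in a domain, this says that the sum of [f] over the
   coroot [a |-> (a, a^-1)] vanishes. *)
Lemma coroot_sum (R : nzRingType) (f : torus F -> R) t :
  (forall t u, f (t * u)%g = f t * f u) ->
  (\sum_(a : {unit F}) f (a, a^-1)%g) * f t =
  (\sum_(a : {unit F}) f (a, a^-1)%g) * f (tswap t).
Proof.
move=> fM; pose b := (t.1 * t.2^-1)%g.
have {1}-> : t = ((b, b^-1)%g * tswap t)%g.
  by rewrite /b; case: t b => x y b; congr pair; rewrite /= ?invMg ?invgK mulgKV.
rewrite fM mulrA mulr_suml [in RHS](reindex_inj (mulIg b)); congr (_ * _).
apply: eq_bigr => a _; rewrite -fM; congr f; congr pair.
by rewrite [RHS]invMg; exact: (congr1 fst (torus_mulC (a^-1, 1) (b^-1, 1))%g).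
Qed.

Lemma coroot_sum_swap (V : zmodType) (f : torus F -> V) :
  \sum_(a : {unit F}) f (tswap (a, a^-1))%g = \sum_(a : {unit F}) f (a, a^-1)%g.
Proof.
rewrite [RHS](reindex_inj invg_inj) /=.
by apply: eq_bigr => a _; rewrite invgK.
Qed.

Lemma eps_T (l : chi) t : is_char l -> eps l * aT t = (l t)%:P *: eps l.
Proof.
move=> lc; rewrite /eps -scalerAl scalerA [_ * (inv_qm1 F ^+ 2)%:P]mulrC -scalerA.
congr (_ *: _); rewrite scaler_sumr mulr_suml.
rewrite [LHS](reindex_inj (mulIg t^-1)%g) /=; apply: eq_bigr => u _.
rewrite -scalerAl scalerA; congr (_ *: _).
  by rewrite invMg invgK lc.2 polyCM.
by apply: val_inj; rewrite [LHS]hecke_TTE mulgKV.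
Qed.

Lemma inv_qm1_sqr : (inv_qm1 F ^+ 2)%:P * (qm1%:R ^+ 2)%:P = 1 :> K.
Proof. by rewrite -polyCM -exprMn inv_qm1K expr1n. Qed.

(** As T_t acts on [eps l] by [l t], the product is [eps l] times a normalized character sum. *)
Lemma eps_mul (l l' : chi) : is_char l -> is_char l' ->
  eps l * eps l' = if l == l' then eps l else 0.
Proof.
move=> lc lc'; rewrite {2}/eps -scalerAr mulr_sumr.
rewrite (eq_bigr (fun t => (l' t^-1%g * l t)%:P *: eps l)); last first.
  by move=> t _; rewrite -scalerAr eps_T // scalerA polyCM.
rewrite -scaler_suml -rmorph_sum; case: eqP => [<-|ll'].
  rewrite (eq_bigr (fun=> 1)); last by move=> t _; rewrite mulrC is_charV.
  rewrite sumr_const card_torus scalerA natrX.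
  by rewrite inv_qm1_sqr scale1r.
by rewrite char_orth ?scale0r ?scaler0 // => e; apply: ll'.
Qed.

Lemma pro_p_eps_T p t : pro_p_eps p * aT t = pro_p_lam p t *: pro_p_eps p.
Proof. exact/eps_T/tchar_is_char. Qed.

Lemma pro_p_eps_sum : \sum_p pro_p_eps p = 1.
Proof.
rewrite -scaler_sumr exchange_big /=.
have E (t : torus F) : \sum_p (tchar p t^-1%g)%:P *: @aT K H t =
    (qm1%:R ^+ 2 *+ (t == 1%g))%:P *: @aT K H t.
  by rewrite -scaler_suml -rmorph_sum tchar_sum invg_eq1.
rewrite (eq_bigr _ (fun t _ => E t)) (bigD1 1%g) //= big1 ?addr0 => [|t t1].
  by rewrite eqxx scalerA inv_qm1_sqr scale1r; apply: val_inj; apply: hecke_T1E.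
by rewrite (negbTE t1) scale0r.
Qed.

Lemma hecke_is_hecke_like : @hecke_like K H 'X Lam pro_p_lam pro_p_sw pro_p_cl pro_p_eps pro_p_aC.
Proof.
split.
- by move=> t u; rewrite !hecke_TTE torus_mulC.
- by case.
- exact: hecke_STE.
- exact: hecke_UTE.
- exact: hecke_UVE.
- exact: hecke_VUE.
- exact: hecke_UUSE.
- exact: hecke_SSE.
- exact: pro_p_aC_val.
- rewrite hecke_cE -scalerAl -scalerAr; congr (_ *: _).
  rewrite mulr_sumr -coroot_sum_swap mulr_suml; apply: eq_bigr => a _.
  by rewrite hecke_STE.
- rewrite hecke_cE -scalerAl -scalerAr; congr (_ *: _).
  rewrite mulr_sumr -coroot_sum_swap mulr_suml; apply: eq_bigr => a _.
  by rewrite hecke_UTE.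
- move=> t; rewrite hecke_cE -scalerAl -scalerAr; congr (_ *: _).
  by rewrite mulr_sumr mulr_suml; apply: eq_bigr => a _; rewrite !hecke_TTE torus_mulC.
- move=> t; rewrite hecke_cE -!scalerAl; congr (_ *: _).
  by apply: coroot_sum => u v; rewrite hecke_TTE.
- exact: hecke_ind.
- by case.
- by move=> p t; rewrite /pro_p_lam -tchar_swap ffunE.
- exact: pro_p_eps_T.
- exact: pro_p_eps_sum.
move=> p; pose T t := psT ('X : K) (pro_p_lam p t) (pro_p_lam p (tswap t)).
have lamM t u : pro_p_lam p (t * u)%g = pro_p_lam p t * pro_p_lam p u.
  by rewrite /pro_p_lam (tchar_is_char p).2 rmorphM.
have ssK (t : torus F) : tswap (tswap t) = t by case: t.
(* The two diagonal entries agree because a -> a^-1 exchanges (a, a^-1) with its swap; so c acts by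
   a scalar. *)
have sumT : ps_scalar 'X (cs_coef F) * (\sum_(a : {unit F}) T (a, a^-1)%g) =
    psT 'X (pro_p_cl p) (pro_p_cl p).
  have -> : \sum_(a : {unit F}) T (a, a^-1)%g =
      psT 'X (\sum_(a : {unit F}) pro_p_lam p (a, a^-1)%g)
          (\sum_(a : {unit F}) pro_p_lam p (a, a^-1)%g).
    rewrite -[in X in psT _ _ X]coroot_sum_swap.
    elim/big_rec3: _ => [|a M x y _ ->]; last by rewrite psTD.
    by rewrite -ps_scalarE rmorph0.
  by rewrite ps_scalarE psTM.
have [||||||||Phi [PhiZ [PhiT PhiS PhiU PhiV]]] := @hecke_lift _ (ps_scalar 'X) T
  (psS 'X (pro_p_cl p)) (psU 'X) (psV 'X) (@ps_scalarC _ _).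
- by move=> t u; rewrite psTM -!lamM.
- have ts1 : tswap (1%g : torus F) = 1%g by [].
  by rewrite /T ts1 /pro_p_lam (tchar_is_char p).1 rmorph1 psT1.
- by move=> t; rewrite /T ssK psST // -!mulrA coroot_sum.
- by move=> t; rewrite /T ssK psUT.
- exact: psUV.
- exact: psVU.
- exact: psUUS.
- by rewrite sumT psSS.
exists Phi => //; split=> //.
rewrite hecke_cE PhiZ rmorph_sum /= -sumT; congr (_ * _).
by apply: eq_bigr => a _; rewrite PhiT.
Qed.

End ProPIwahoriModel.

(* [(R['X])[Z]] embeds into [(R[Z])['X]]. *)
Lemma groupRing_polyX_nzd (R : comNzRingType) (G : zmodType)
  (p : groupRing {poly R} G) : 'X *: p = 0 -> p = 0.
Proof.
pose L := {poly groupRing R G}; pose M := groupRing {poly R} G.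
pose phi : {rmorphism {poly R} -> L} := map_poly (in_alg (groupRing R G)).
have phiC k (y : L) : phi k * y = y * phi k by rewrite mulrC.
have [|j [jZ jg]] := @presAlg_lift _ _ (group_pres {poly R} G) L phi
    (fun g => (gexp R g)%:P) phiC.
  by move=> x y [|g h] /=; rewrite ?gexp0 ?gexpD !(rmorph1, rmorphM).
pose psi : {rmorphism R -> M} := in_alg M \o @polyC R.
have psiC k (y : M) : psi k * y = y * psi k by rewrite mulrC.
have [|i0 [i0Z i0g]] := @presAlg_lift _ _ (group_pres R G) M psi
    (gexp {poly R} (G:=G)) psiC.
  by move=> x y [|g h] /=; rewrite ?gexp0 ?gexpD // scale1r.
have ci : commr_rmorph i0 ('X%:A : M) by move=> a; apply: mulrC.
pose i : {rmorphism L -> M} := horner_morph ci.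
have iphi k : i (phi k) = k%:A.
  elim/poly_ind: k => [|k c IHk]; first by rewrite !rmorph0 scale0r.
  rewrite !(rmorphD, rmorphM) /= IHk map_polyX map_polyC /=.
  rewrite horner_morphX horner_morphC i0Z rmorph1 mulr1 scalerDl.
  by rewrite mulr_algl scalerA mulrC.
have ij : cancel j i.
  elim/presAlg_ind => [k|g|x y ex ey|x y ex ey].
  - by rewrite jZ rmorph1 mulr1 iphi.
  - by rewrite jg; rewrite [LHS]horner_morphC i0g.
  - by rewrite !rmorphD /= ex ey.
  - by rewrite !rmorphM /= ex ey.
move=> p0; apply: (can_inj ij); rewrite rmorph0.
have := congr1 j p0; rewrite jZ rmorph0 /= map_polyX.
by apply: monic_nzd; apply: monicX.
Qed.

(** * The Demazure-Vignéras representation of the pro-p algebra *)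

Section ProPIwahoriRepresentation.
Variables (F : finFieldType) (ord : pred {ffun torus F -> Zt F}).
Hypothesis ordP : orbit_order ord.
Local Notation K := {poly Zt F}.
Local Notation H := (hecke F).
Local Notation chi := {ffun torus F -> Zt F}.
Local Notation Lam := (Iirr [set: {unit F}] * Iirr [set: {unit F}])%type.
Let hyp := hecke_is_hecke_like F.
Local Notation aswap := (aswap hyp).
Local Notation arest := (arest hyp).
Local Notation mulC := (Asub_mulC hyp).
Local Notation mulCA := (mulCA hyp).

(* The value at [l] of the image [u0] of [U] in the representation: [X] on a
   non-regular component, and [U eps_1 = eps_2], [U eps_2 = z_2 eps_1] on a
   regular one. *)
Definition u0_at (l : chi) : Asub H :=
  if char_swap l == l then aX H else if ord l then az H else 1.

Definition pro_p_u0 : Asub H := \sum_p pro_p_eps p * u0_at (tchar p).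

Lemma eps_pro_p_eps (l : chi) p : is_char l ->
  eps l * pro_p_eps p = if l == tchar p then eps l else 0.
Proof. by move=> lc; rewrite eps_mul //; apply: tchar_is_char. Qed.

Lemma eps_pro_p_u0 (l : chi) : is_char l -> eps l * pro_p_u0 = eps l * u0_at l.
Proof.
move=> lc; rewrite /pro_p_u0 mulr_sumr -[RHS]mulr1 -mulrA [u0_at l * 1]mulC mulrA.
rewrite -(pro_p_eps_sum F) mulr_sumr mulr_suml; apply: eq_bigr => p _.
by rewrite mulrA eps_pro_p_eps //; case: eqP => [->//|]; rewrite !mul0r.
Qed.

Lemma char_swapK (l : chi) : char_swap (char_swap l) = l.
Proof. by apply/ffunP=> -[a b]; rewrite !ffunE. Qed.

Lemma char_swap_is_char (l : chi) : is_char l -> is_char (char_swap l).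
Proof.
move=> [l1 lM]; split=> [|t u]; rewrite !ffunE; first exact: l1.
by rewrite -lM.
Qed.

Lemma aswap_eps (l : chi) : aswap (eps l) = eps (char_swap l) /\ arest (eps l) = 0.
Proof.
have sZ k a b : aswap a = b /\ arest a = 0 -> aswap (k *: a) = k *: b /\ arest (k *: a) = 0.
  by move=> [e e']; have [-> ->] := aswap_arestZ hyp k a; rewrite e e' scaler0.
apply: (sZ); rewrite [X in _ = X /\ _](reindex_inj (can_inj (hl_sK hyp))) /=.
elim/big_rec2: _ => [|t a b _ [ea eb]].
  have := sZ 0 0 0; rewrite scale0r; apply; split; first exact: aswap0.
  by have [_] := aswap_arestZ hyp 0 0; rewrite !scale0r.
have [-> ->] := aswap_arestD hyp ((l t^-1%g)%:P *: @aT K H t) b.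
have [-> ->] := aswap_arestZ hyp (l t^-1%g)%:P (@aT K H t).
have [-> ->] := aswap_arestT hyp t.
by rewrite ea eb scaler0 addr0 /char_swap ffunE.
Qed.

Lemma eps_orth (l : chi) : is_char l -> char_swap l <> l -> eps l * eps (char_swap l) = 0.
Proof.
move=> lc ll; rewrite eps_mul //; last exact: char_swap_is_char.
by case: eqP => // e; case: ll.
Qed.

Lemma eps_idem (l : chi) : is_char l -> eps l * eps l = eps l.
Proof. by move=> lc; rewrite eps_mul // eqxx. Qed.

(** A swap-invariant character is trivial on every (a, a^-1), so the sum over a acts by q - 1, and
    the factor [cs_coef] turns this into 'X - 1. *)
Lemma eps_pro_p_aC (l : chi) : is_char l -> char_swap l = l ->
  pro_p_aC F * eps l = ('X - 1) *: eps l.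
Proof.
move=> lc ll; rewrite mulC /pro_p_aC -scalerAr mulr_sumr.
rewrite (eq_bigr (fun=> eps l)) => [|a _].
  by rewrite sumr_const -cardsT card_finField_unit -cs_coef_qm1 -[RHS]scalerA scaler_nat.
rewrite (eps_T (a, a^-1)%g lc) -[RHS]scale1r; congr (_ *: _).
have -> : ((a, a^-1)%g : torus F) = ((a, 1) * (1, a^-1))%g.
  by congr pair; rewrite /= ?mulg1 ?mul1g.
rewrite lc.2 -{1}ll ffunE /tswap /= -lc.2.
have -> : ((1, a) * (1, a^-1))%g = 1%g :> torus F.
  by congr pair; rewrite /= ?mulg1 ?mulgV.
by rewrite lc.1.
Qed.

(** At [l] the swapped factor takes its value from [char_swap l]. For l fixed by the swap this is Y
    X - (q - 1) z_2 = z_2; otherwise the two values are z_2 and 1 in some order and r vanishes. *)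
Lemma pro_p_u0P : aswap pro_p_u0 * pro_p_u0 + arest pro_p_u0 = az H.
Proof.
apply/eqP; rewrite -subr_eq0; apply/eqP; apply: (Asub_eq0 hyp) => p.
have lc := tchar_is_char p; rewrite /pro_p_eps; move: (tchar p) lc => l lc.
set l' := char_swap l; have lc' : is_char l' := char_swap_is_char lc.
have [sl rl] := aswap_eps l'; rewrite char_swapK in sl.
have [e1 e2] : eps l * aswap pro_p_u0 = eps l * aswap (u0_at l') /\
    eps l * arest pro_p_u0 = eps l * arest (u0_at l').
  have E a : eps l * aswap a = aswap (eps l' * a) /\
      eps l * arest a = arest (eps l' * a).
    have [-> ->] := aswap_arestM hyp (eps l') a.
    by rewrite sl rl mul0r add0r.
  by rewrite (E pro_p_u0).1 (E pro_p_u0).2 (E _).1 (E _).2 eps_pro_p_u0.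
rewrite mulrBr mulrDr mulrA e1 e2 -mulrA mulCA eps_pro_p_u0 // /u0_at char_swapK.
rewrite [l == _]eq_sym; case: (altP (l' =P l)) => [ll|ll].
  rewrite (aswapX hyp) (arestX hyp) mulrN.
  have e3 : eps l * (az H * pro_p_aC F) = ('X - 1) *: (eps l * az H).
    by rewrite [az H * _]mulC mulrA [eps l * pro_p_aC F]mulC eps_pro_p_aC // scalerAl.
  rewrite e3 mulCA [aY H * _]mulC (aXY hyp) -scalerAr -scalerBl.
  by rewrite opprB addrCA subrr addr0 scale1r subrr.
have ord' : ord l' = ~~ ord l by apply: ordP => //; apply/eqP.
rewrite ord'; case: (ord l) => /=.
  have [-> ->] := aswap_arest1 hyp.
  by rewrite mulr0 addr0 mul1r subrr.
have [-> ->] := aswap_arestz hyp.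
by rewrite mulr0 addr0 mulr1 mulC subrr.
Qed.

(** Test elements: f = X on a non-regular component, where the factor becomes z_2 - X^2; f = [eps l]
    on a regular one, where its [l]-part is minus u0, that is minus 1 or minus z_2, a unit. *)
Lemma pro_p_u0_faithful b :
  (forall f, b * (aswap f * pro_p_u0 + arest f - f * pro_p_u0) = 0) -> b = 0.
Proof.
move=> b0; apply: (Asub_eq0 hyp) => p.
have lc := tchar_is_char p; rewrite /pro_p_eps; move: (tchar p) lc => l lc.
have := eps_pro_p_u0 lc; rewrite /u0_at; case: eqP => [ll|ll] eu.
  have key : eps l * (aY H * pro_p_u0 - az H * pro_p_aC F - aX H * pro_p_u0) =
      eps l * (az H - aX H ^+ 2).
    rewrite !mulrBr ![eps l * (_ * pro_p_u0)]mulCA eu ![_ * (eps l * aX H)]mulCA.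
    rewrite expr2 [aY H * _]mulC (aXY hyp) [az H * _]mulC [eps l * (pro_p_aC F * _)]mulrA.
    rewrite [eps l * pro_p_aC F]mulC eps_pro_p_aC // -[(_ *: eps l) * _]scalerAl.
    rewrite -[eps l * ('X *: _)]scalerAr -scalerBl.
    by rewrite opprB addrCA subrr addr0 scale1r.
  apply: (nzd_zX2 hyp); rewrite mulC -mulrA mulCA -key mulCA.
  by have := b0 (aX H); rewrite (aswapX hyp) (arestX hyp) => ->; rewrite mulr0.
have := b0 (eps l); have [-> ->] := aswap_eps l; rewrite addr0 mulrBr => b1.
have : eps l * (b * (eps l * pro_p_u0)) = 0.
  have := congr1 (fun a => eps l * a) b1; rewrite mulr0 mulrBr ![eps l * (b * _)]mulCA.
  rewrite [eps l * (eps _ * _)]mulrA eps_orth // mul0r mulr0 sub0r.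
  by rewrite [eps l * (eps l * pro_p_u0)]mulrA eps_idem // => /eqP; rewrite oppr_eq0 => /eqP.
rewrite mulCA [eps l * (_ * _)]mulrA eps_idem // eu mulCA mulrA.
case: (ord l) => e; last by rewrite mulr1 in e.
by rewrite -[LHS]mulr1 -(az_azV hyp) mulrA e mul0r.
Qed.

Definition pro_p_rep := hrep hyp pro_p_u0.

Lemma pro_p_faithful : faithful_rep pro_p_rep.
Proof. exact: (hrep_inj pro_p_u0_faithful). Qed.

Lemma pro_p_demazure_vigneras : demazure_vigneras ord (pro_p_rep (hS H)).
Proof.
split=> [a b|l lc ll ol|l lc ll].
- by rewrite /pro_p_rep /hrep avalD mulrDr projD.
- have lc' := char_swap_is_char lc.
  have [s1 r1] := aswap_eps l; have [s2 r2] := aswap_eps (char_swap l).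
  rewrite char_swapK in s2.
  apply: (@hrep_vigneras _ _ _ _ _ _ _ _ _ hyp) => //; rewrite ?eps_idem ?eps_orth //.
  + by rewrite eps_pro_p_u0 // /u0_at; case: eqP => // _; rewrite ol mulC.
  + rewrite eps_pro_p_u0 // /u0_at char_swapK; case: eqP => [e|_]; first by case: ll.
    by rewrite ordP // ol mulr1.
have [s1 r1] := aswap_eps l; rewrite ll in s1.
apply: (@hrep_demazure _ _ _ _ _ _ _ _ _ hyp); rewrite ?eps_idem //.
- move=> t; rewrite (eps_T t lc) (eps_T (tswap t) lc); congr (_%:P *: _).
  by rewrite -{1}ll ffunE.
- exact: eps_pro_p_aC.
- by rewrite eps_pro_p_u0 // /u0_at ll eqxx.
Qed.

(** Only rho(S)(1) matters. Since 1 is the sum of the [eps l], additivity reduces it to the values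
    on these idempotents, all prescribed by condition (ii). *)
Lemma pro_p_uniq rho : hecke_rep rho -> extends_mul rho ->
  demazure_vigneras ord (rho (hS H)) -> forall h, rho h =1 pro_p_rep h.
Proof.
move=> rep_rho rhoA [rhoD rhoV rhoN].
have [pD pV pN] := pro_p_demazure_vigneras.
apply: (@hrep_uniq _ _ _ _ _ _ _ _ _ hyp) => //; first exact: groupRing_polyX_nzd.
have f0 (f : Asub H -> Asub H) : (forall a b, f (a + b) = f a + f b) -> f 0 = 0.
  by move=> fD; apply: (addrI (f 0)); rewrite -fD !addr0.
have E l : is_char l -> rho (hS H) (eps l) = pro_p_rep (hS H) (eps l).
  move=> lc; have lc' := char_swap_is_char lc.
  have [ll|ll] := pselect (char_swap l = l).
    have [s1 _] := aswap_eps l; rewrite ll in s1.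
    have e := demazure_on_idem (eps_idem lc) s1.
    by rewrite (e _ (rhoN _ lc ll)) (e _ (pN _ lc ll)).
  have [ol|nol] := boolP (ord l).
    by have [_ _ -> _] := rhoV _ lc ll ol; have [_ _ -> _] := pV _ lc ll ol.
  (* If [ord] fails at [l], then [eps l] is the second idempotent of the ordered pair starting with
     [char_swap l]. *)
  have ll' : char_swap (char_swap l) <> char_swap l.
    by rewrite char_swapK => e; apply: ll.
  have ol' : ord (char_swap l) by rewrite ordP.
  have [_ _ _] := rhoV _ lc' ll' ol'; have [_ _ _] := pV _ lc' ll' ol'.
  by rewrite char_swapK => -> ->.
rewrite -[hrep _ _]/pro_p_rep -(pro_p_eps_sum F).
rewrite (big_morph _ rhoD (f0 _ rhoD)) (big_morph _ pD (f0 _ pD)).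
by apply: eq_bigr => p _; apply/E/tchar_is_char.
Qed.

End ProPIwahoriRepresentation.

(** * The Iwahori-Hecke algebra and the Bernstein isomorphism *)

Section IwahoriRepresentation.
Variables (K : comNzRingType) (qq : K).
Local Notation H := (iwahori qq).
Let hyp := iwahori_hecke_like qq.
Local Notation mulC := (Asub_mulC hyp).

Definition iwahori_rep := hrep hyp (aX H).

Lemma iwahori_u0 : aswap hyp (aX H) * aX H + arest hyp (aX H) = az H.
Proof.
rewrite (aswapX hyp) (arestX hyp) mulC (aXY hyp) -scalerAr mulr1.
by rewrite scalerBl scale1r opprB addrCA subrr addr0.
Qed.

Lemma iwahori_rep_faithful : faithful_rep iwahori_rep.
Proof.
apply: hrep_inj => b b0; apply: (nzd_zX2 hyp).
have := b0 (aX H); rewrite (aswapX hyp) addrAC -expr2 mulC; congr (_ * _ = _).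
rewrite -addrA [- _ + _]addrC addrA; congr (_ - _); rewrite -iwahori_u0.
by rewrite (aswapX hyp).
Qed.

Lemma iwahori_rep_hecke_rep : hecke_rep iwahori_rep.
Proof. exact: (hrep_rep iwahori_u0 iwahori_rep_faithful). Qed.

Lemma iwahori_rep_extends_mul : extends_mul iwahori_rep.
Proof. exact: hrep_extends_mul. Qed.

Lemma iwahori_T (i : hidx H) : 1 * aT i = 1 * aT (hswap i).
Proof. by case: i. Qed.

Definition iwahori_ddiff := ddiff hyp (e := 1) iwahori_T.

Lemma iwahori_ddiffP a : a - aswap hyp a = (aY H - aX H) * iwahori_ddiff a.
Proof. by rewrite -ddiffP mul1r. Qed.

Lemma iwahori_rep_demazure : demazure_on qq 1 (iwahori_rep (hS H)).
Proof.
apply: hrep_demazure; rewrite ?mulr1 //; first exact: aswap1.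
Qed.

Lemma iwahori_repS a :
  iwahori_rep (hS H) a = qq *: aswap hyp a + (qq - 1) *: (aY H * iwahori_ddiff a).
Proof.
by apply: hrepS_ddiff; rewrite ?mulr1 ?mul1r //; apply: aswap1.
Qed.

End IwahoriRepresentation.

(** * The Bernstein isomorphism *)

Section Bernstein.
Local Notation q := (vpow 2).
Local Notation v := (vpow 1).
Local Notation vi := (vpow (-1)).
Local Notation H := Hhalf.
Local Notation A := (Asub Hhalf).
Let hyp := iwahori_hecke_like q.
Local Notation mulC := (Asub_mulC hyp).
Local Notation aswap := (aswap hyp).

Lemma vpowD m n : vpow (m + n) = vpow m * vpow n.
Proof. exact: gexpD. Qed.

Lemma vpowVK n : vpow (- n) * vpow n = 1.
Proof. by rewrite -vpowD addNr /vpow gexp0. Qed.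

Lemma vpowKV n : vpow n * vpow (- n) = 1.
Proof. by rewrite -vpowD addrN /vpow gexp0. Qed.

(* The images of [e^(1,0)], [e^(0,1)] and of their inverses. *)
Definition bern_x : A := vi *: aX H.
Definition bern_y : A := vi *: aY H.
Definition bern_xV : A := bern_y * azV H.
Definition bern_yV : A := bern_x * azV H.

Lemma bern_xy : bern_x * bern_y = az H.
Proof.
rewrite -scalerAl -scalerAr scalerA (aXY hyp) scalerA -!vpowD.
by rewrite (_ : -1 + -1 + 2 = 0 :> int) // /vpow gexp0 scale1r.
Qed.

Lemma bern_xK : bern_x * bern_xV = 1.
Proof. by rewrite mulrA bern_xy (az_azV hyp). Qed.

Lemma bern_yK : bern_y * bern_yV = 1.
Proof. by rewrite mulrA [bern_y * _]mulC bern_xy (az_azV hyp). Qed.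

Definition bern (l : Lambda) : A :=
  ipow bern_x bern_xV l.1 * ipow bern_y bern_yV l.2.

Lemma bern0 : bern 0 = 1.
Proof. by rewrite /bern /= mulr1. Qed.

Lemma bernD a b : bern (a + b) = bern a * bern b.
Proof.
have xK' : bern_xV * bern_x = 1 by rewrite mulC bern_xK.
have yK' : bern_yV * bern_y = 1 by rewrite mulC bern_yK.
rewrite /bern /= (ipowD bern_xK xK') (ipowD bern_yK yK') -!mulrA; congr (_ * _).
by rewrite !mulrA; congr (_ * _); apply: mulC.
Qed.

Lemma Lambda_mulz (a b n : int) : ((a, b) : Lambda) *~ n = (a * n, b * n).
Proof.
elim/int_rec: n => [|n IHn|n IHn]; first by rewrite mulr0z !mulr0.
  by rewrite -addn1 PoszD mulrzDr IHn mulr1z !mulrDr !mulr1.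
by rewrite -addn1 PoszD opprD mulrzDr IHn !mulrDr mulrNz mulr1z !mulrN1.
Qed.

Lemma bernstein_iso : exists (theta : {lrmorphism ZLambda -> A})
    (thetaV : {lrmorphism A -> ZLambda}),
  [/\ cancel theta thetaV, cancel thetaV theta & forall l, theta (e_ l) = bern l].
Proof.
have [theta thetaE] := groupRing_lift bern0 bernD.
have [chi [chiX chiY chiz] _] := chi_ex hyp tt.
have eM (a b : Lambda) : e_ (a + b) = e_ a * e_ b by apply: gexpD.
have [||||||||eta [etax etay etaz etai]] :=
  @compRing_lift_alg _ q ZLambda (v *: e_ (1, 0)) (v *: e_ (0, 1)) (e_ (1, 1)) (e_ (-1, -1)).
- exact: mulrC.
- exact: mulrC.
- exact: mulrC.
- exact: mulrC.
- exact: mulrC.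
- exact: mulrC.
- by rewrite -scalerAl -scalerAr scalerA -vpowD -eM.
- by rewrite -eM; apply: gexp0.
have [tV tVE] : exists tV : {lrmorphism A -> ZLambda}, tV =1 eta \o chi.
  by exists (eta \o chi : {lrmorphism A -> ZLambda}).
have tVx : tV bern_x = e_ (1, 0).
  by rewrite linearZ /= tVE /= chiX etax scalerA vpowVK scale1r.
have tVy : tV bern_y = e_ (0, 1).
  by rewrite linearZ /= tVE /= chiY etay scalerA vpowVK scale1r.
have gx n : ipow (e_ (1, 0)) (tV bern_xV) n = e_ ((1, 0) *~ n).
  by rewrite -[LHS]gexp_ipow // -[gexp _ _]tVx -rmorphM bern_xK rmorph1.
have gy n : ipow (e_ (0, 1)) (tV bern_yV) n = e_ ((0, 1) *~ n).
  by rewrite -[LHS]gexp_ipow // -[gexp _ _]tVy -rmorphM bern_yK rmorph1.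
have thetaK : cancel theta tV.
  elim/groupRing_ind=> [f g ef eg|k f ef|l].
  - by rewrite !rmorphD /= ef eg.
  - by rewrite !linearZ /= ef.
  rewrite thetaE /bern rmorphM !rmorph_ipow /= tVx tVy.
  rewrite gx gy -eM; case: l => a b; congr e_.
  by rewrite !Lambda_mulz !mul0r !mul1r; congr pair; rewrite /= ?addr0 ?add0r.
have thetax : theta (e_ (1, 0)) = bern_x by rewrite thetaE /bern /= mulr1.
have thetay : theta (e_ (0, 1)) = bern_y by rewrite thetaE /bern /= mul1r.
have thetaz : theta (e_ (1, 1)) = az H by rewrite thetaE /bern /= bern_xy.
have surj a : exists f, theta f = a.
  elim/subalg_ind: a => [k|[]||||| a b [f <-] [g <-]| a b [f <-] [g <-]].
  - by exists (k *: 1); rewrite linearZ rmorph1.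
  - by exists (v *: e_ (1, 0)); rewrite linearZ /= thetax scalerA vpowKV scale1r.
  - by exists (v *: e_ (0, 1)); rewrite linearZ /= thetay scalerA vpowKV scale1r.
  - by exists (e_ (1, 1)).
  - exists (e_ (-1, -1)).
    have e : theta (e_ (-1, -1)) * az H = 1.
      have e0 : e_ ((-1, -1) + (1, 1)) = 1 by apply: gexp0.
      by rewrite -thetaz -rmorphM -eM e0 rmorph1.
    by rewrite -[LHS]mulr1 -(az_azV hyp) mulrA e mul1r.
  - by exists (f + g); rewrite rmorphD.
  - by exists (f * g); rewrite rmorphM.
exists theta, tV; split=> // a.
by have [f <-] := surj a; rewrite thetaK.
Qed.

Lemma aswap_bern l : aswap (bern l) = bern (lswap l).
Proof.
have [f _ fE] := aswap_lrmorphism hyp.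
have fx : f bern_x = bern_y by rewrite linearZ /= fE (aswapX hyp).
have fy : f bern_y = bern_x by rewrite linearZ /= fE (aswapY hyp).
have fzV : f (azV H) = azV H by rewrite fE (aswapzV hyp).
have fyV : f bern_yV = bern_xV by rewrite rmorphM /= fx fzV.
have fxV : f bern_xV = bern_yV by rewrite rmorphM /= fy fzV.
by rewrite -fE rmorphM !rmorph_ipow /= fx fy fxV fyV mulC.
Qed.

Lemma bern_z n : val (bern (n, n)) = z2pow H n.
Proof.
suff -> : bern (n, n) = ipow (az H) (azV H) n by case: n => m; rewrite rmorphXn.
elim/int_rec: n => [|n IHn|n IHn]; first exact: bern0.
  rewrite -addn1 PoszD (ipowS (azV_az hyp)) -IHn.
  by rewrite -[(_, _)]/((Posz n, Posz n) + (1, 1) : Lambda) bernD {2}/bern /= bern_xy.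
rewrite -addn1 PoszD opprD (ipowP (az_azV hyp) (azV_az hyp)) -IHn.
rewrite -[(_, _)]/((- Posz n, - Posz n) + (-1, -1) : Lambda) bernD; congr (_ * _).
rewrite -[LHS]/(bern_xV * bern_yV) -mulrA [azV H * _]mulC mulrA mulrA.
by rewrite [bern_y * _]mulC bern_xy (az_azV hyp) mul1r.
Qed.

(** An antidominant weight is (n, n) + (0, k): the first summand gives z_2^n, the second k factors
    v^-1 Y. *)
Lemma bern_diag n (k : nat) :
  val (bern (n, n + k%:Z)) = vpow (- k%:Z) *: (hY H ^+ k * z2pow H n).
Proof.
have -> : (n, n + k%:Z) = (n, n) + (0, k%:Z) :> Lambda by congr pair; rewrite /= addr0.
have yk : val (bern_y ^+ k) = vpow (- k%:Z) *: hY H ^+ k.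
  elim: k => [|k IHk]; first by rewrite !expr0 /vpow gexp0 scale1r.
  rewrite exprSr avalM IHk avalZ -scalerAr -scalerAl scalerA -vpowD -exprSr.
  by rewrite -opprD -PoszD add1n.
rewrite bernD [X in val X]mulC avalM bern_z -[bern _]/(1 * bern_y ^+ k) mul1r yk.
by rewrite -scalerAl.
Qed.

Lemma bern_antidom l : antidominant l ->
  val (bern l) = vpow (- len l) *: Tantidom H l.
Proof.
case: l => n m nm; have [k ->] : exists k : nat, m = n + k%:Z.
  exists `|m - n|%N; rewrite gez0_abs ?subr_ge0 //.
  by rewrite addrCA subrr addr0.
rewrite bern_diag; congr (vpow (- _) *: (_ ^+ _ * _)).
  by rewrite /len /= opprD addrA subrr add0r normrN.
by rewrite /= addrAC subrr add0r.
Qed.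

Lemma bern_bernstein (theta : {lrmorphism ZLambda -> A}) : bijective theta ->
  (forall l, theta (e_ l) = bern l) -> is_bernstein theta.
Proof.
move=> bij thetaE; split=> // l1 l2 a1 a2.
have bV : bern l2 * bern (- l2) = 1 by rewrite -bernD subrr bern0.
have T2 : Tantidom H l2 = val (vpow (len l2) *: bern l2).
  by rewrite avalZ bern_antidom // scalerA vpowKV scale1r.
exists (val (vpow (- len l2) *: bern (- l2))).
  rewrite T2 -!avalM -scalerAl -scalerAr -scalerAl -scalerAr !scalerA.
  by rewrite [bern (- l2) * _]mulC bV vpowKV vpowVK scale1r.
rewrite thetaE bernD avalM bern_antidom // avalZ -!scalerAl -scalerAr !scalerA.
by rewrite -mulrA vpowKV mulr1.
Qed.

End Bernstein.

(** * The classical spherical representation *)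

Section Spherical.
Local Notation q := (vpow 2).
Local Notation H := Hhalf.
Local Notation A := (Asub Hhalf).
Let hyp := iwahori_hecke_like q.
Local Notation mulC := (Asub_mulC hyp).
Local Notation aswap := (aswap hyp).
Variables (theta : {lrmorphism ZLambda -> A}) (thetaV : {lrmorphism A -> ZLambda}).
Hypotheses (thetaK : cancel theta thetaV) (thetaVK : cancel thetaV theta).
Hypothesis thetaE : forall l, theta (e_ l) = bern l.

Definition spherical_rep (h : H) (f : ZLambda) : ZLambda := thetaV (iwahori_rep h (theta f)).

Lemma e_D a b : e_ (a + b) = e_ a * e_ b.
Proof. exact: gexpD. Qed.

Lemma ZLambda_swap : exists s : {lrmorphism ZLambda -> ZLambda},
  forall l, s (e_ l) = e_ (lswap l).
Proof. by apply: groupRing_lift => [|a b]; [apply: gexp0 | rewrite -e_D]. Qed.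

Lemma aswap_theta (s : {lrmorphism ZLambda -> ZLambda}) f :
  (forall l, s (e_ l) = e_ (lswap l)) -> aswap (theta f) = theta (s f).
Proof.
move=> sE; elim/groupRing_ind: f => [f g ef eg|k f ef|l].
- by rewrite !rmorphD /= aswapD ef eg.
- by rewrite !linearZ /= aswapZ ef.
- by rewrite -/(e_ l) sE !thetaE aswap_bern.
Qed.

Definition sph_x : ZLambda := thetaV (aX H).
Definition sph_y : ZLambda := thetaV (aY H).
Definition sph_diff (f : ZLambda) : ZLambda := thetaV (iwahori_ddiff (theta f)).

Lemma sph_diffP (s : {lrmorphism ZLambda -> ZLambda}) f :
  (forall l, s (e_ l) = e_ (lswap l)) ->
  f - s f = (sph_y - sph_x) * sph_diff f.
Proof.
move=> sE; rewrite -rmorphB -rmorphM /= -iwahori_ddiffP (aswap_theta f sE).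
by rewrite -rmorphB thetaK.
Qed.

(** Hence Y - X = - (e^alpha - 1) Y, which converts the divided differences of A into the quotients
    by e^alpha - 1. *)
Lemma sph_alpha : sph_x = e_ alpha * sph_y.
Proof.
have x1 : bern (1, 0) = bern_x by rewrite /bern mulr1.
have y1 : bern (0, 1) = bern_y by rewrite /bern mul1r.
have xy : bern_x = bern alpha * bern_y by rewrite -x1 -y1 -bernD.
have E a : a = vpow 1 *: (vpow (-1) *: a) :> A by rewrite scalerA vpowKV scale1r.
rewrite /sph_x [aX H]E -/bern_x xy scalerAr -E -thetaE rmorphM /=.
by rewrite thetaK.
Qed.

Lemma sph_nzd (f : ZLambda) : (e_ alpha - 1) * f = 0 -> f = 0.
Proof.
move=> f0; apply: (can_inj thetaK); rewrite rmorph0; apply: (nzd_YX hyp).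
apply: (can_inj thetaVK); rewrite rmorph0 rmorphM rmorphB /= thetaK.
rewrite -/sph_x -/sph_y sph_alpha.
have -> : (sph_y - e_ alpha * sph_y) * f = - sph_y * ((e_ alpha - 1) * f) by ring.
by rewrite f0 mulr0.
Qed.

Lemma sph_rep : is_rep ZLambda_linear spherical_rep.
Proof.
have [irep_lin irepD irepM irep1 irepZ] := iwahori_rep_hecke_rep q.
split=> [h|h h' f|h h' f|f|k h f].
- have [hD hz] := irep_lin h; split=> [f g|c f].
    by rewrite /spherical_rep -rmorphD [theta (f + g)]rmorphD; congr (thetaV _); apply: hD.
  case=> s sE sc; have cC : central (val (theta c)).
    by apply: (invariant_central (hyp := hyp)); rewrite (aswap_theta c sE) sc.
  rewrite /spherical_rep rmorphM; apply: (can_inj thetaK); rewrite thetaVK rmorphM /= thetaVK.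
  have e : val (iwahori_rep h (theta c * theta f)) = val (theta c * iwahori_rep h (theta f)).
    exact: (hz _ cC (theta f) (theta c * theta f) erefl).
  exact: val_inj e.
- by rewrite /spherical_rep irepD rmorphD.
- by rewrite /spherical_rep irepM thetaVK.
- by rewrite /spherical_rep irep1 thetaK.
- by rewrite /spherical_rep irepZ linearZ.
Qed.

Lemma spherical_repA l f : spherical_rep (val (theta (e_ l))) f = e_ l * f.
Proof. by rewrite /spherical_rep iwahori_rep_extends_mul -rmorphM thetaK. Qed.

Lemma spherical_repS f (s : {lrmorphism ZLambda -> ZLambda}) :
  (forall l, s (e_ l) = e_ (lswap l)) ->
  spherical_rep (hS H) f = q *: s f + (q - 1) *: (sph_y * sph_diff f).
Proof.
move=> sE; rewrite /spherical_rep iwahori_repS rmorphD /= !linearZ /= rmorphM /=.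
by rewrite (aswap_theta f sE) thetaK.
Qed.

Lemma sph_classical : is_classical_spherical theta spherical_rep.
Proof.
split; [exact: sph_rep | exact: spherical_repA | move=> l].
have [s sE] := ZLambda_swap.
have := sph_diffP (e_ l) sE; have := sph_alpha.
(* With e_l - s(e_l) = (Y - X) G and X = e^alpha Y, the first quotient is - Y G. The second
   numerator is e_l - e^alpha (e_l - (Y - X) G) = - (e^alpha - 1)(e_l + X G). *)
set X := sph_x; set Y := sph_y; set G := sph_diff _ => eX eG.
exists (- (Y * G)), (- (e_ l + X * G)); rewrite (spherical_repS (e_ l) sE) e_D -sE -/Y -/G.
have -> : s (e_ l) = e_ l - (Y - X) * G by rewrite -eG opprB addrC subrK.
split.
- by rewrite eX; ring.
- by rewrite eX; ring.
- rewrite -[q *: _]mulr_algl -[(q - 1) *: _]mulr_algl -[q *: - _]mulr_algl.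
  by rewrite scalerBl scale1r; set k := q%:A; ring.
Qed.

(** Operators linear over the invariants are linear over the constants, hence determined on the e^l;
    there S is determined because e^alpha - 1 cancels. Over Z[q^(1/2), q^(-1/2)] the parameter q is
    invertible and U = q^-1 X S, so S and A determine the rest. *)
Lemma spherical_uniq sigma : is_classical_spherical theta sigma ->
  forall h, sigma h =1 spherical_rep h.
Proof.
move=> [sig_rep sigA sigS]; have [sph_lin sphD sphM sph1 sphZ] := sph_rep.
have [sig_lin sigD sigM sig1 sigZ] := sig_rep.
have [_ _ sphS'] := sph_classical.
have [s sE] := ZLambda_swap.
have kinv (k : Zhalf) : ZLambda_invariant k%:A.
  by exists s => //; rewrite linearZ rmorph1.
have linZ g : ZLambda_linear g -> forall k f, g (k *: f) = k *: g f.
  by move=> [_ gl] k f; rewrite -mulr_algl gl // mulr_algl.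
have ext g g' : ZLambda_linear g -> ZLambda_linear g' ->
    (forall l, g (e_ l) = g' (e_ l)) -> g =1 g'.
  move=> gl gl' gg'; elim/groupRing_ind=> [f f' ef ef'|k f ef|l]; last exact: gg'.
    by rewrite gl.1 gl'.1 ef ef'.
  by rewrite !linZ // ef.
have eS : sigma (hS H) =1 spherical_rep (hS H).
  apply: ext => // l; have [d [d' [ed ed' ->]]] := sigS l.
  have [c [c' [ec ec' ->]]] := sphS' l.
  have U a b : a * (e_ alpha - 1) = b * (e_ alpha - 1) -> a = b.
    move=> ab; apply/eqP; rewrite -subr_eq0; apply/eqP/sph_nzd.
    by rewrite mulrC mulrBl ab subrr.
  by rewrite (U _ _ (etrans ed (esym ec))) (U _ _ (etrans ed' (esym ec'))).
have eA (a : A) f : sigma (val a) f = spherical_rep (val a) f.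
  rewrite -[a]thetaVK; elim/groupRing_ind: (thetaV a) => [g g' eg eg'|k g eg|l].
  - by rewrite rmorphD avalD sigD sphD eg eg'.
  - by rewrite linearZ avalZ sigZ sphZ eg.
  - by rewrite -/(e_ l) sigA spherical_repA.
have eU : sigma (hU H) =1 spherical_rep (hU H).
  move=> f; have -> : hU H = vpow (- 2) *: (hX H * hS H).
    by rewrite (hXS hyp) scalerA vpowVK scale1r.
  by rewrite sigZ sphZ sigM sphM eS; congr (_ *: _); apply: (eA (aX H)).
move=> h f; rewrite (hcoordP hyp h) sigD sphD sigM sphM eU.
by rewrite !eA.
Qed.

End Spherical.

(** * The Iwahori component *)

Lemma iwahori_base_change (K K' : comNzRingType) (qq : K) (qq' : K')
    (phi : {rmorphism K -> K'}) : phi qq = qq' ->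
  exists b : {rmorphism iwahori qq -> iwahori qq'}, is_base_change phi b.
Proof.
move=> phiq.
pose psi : {rmorphism K -> iwahori qq'} := in_alg (iwahori qq') \o phi.
have psiC k (y : iwahori qq') : psi k * y = y * psi k.
  by rewrite /= mulr_algl mulr_algr.
have hyp := iwahori_hecke_like qq'.
have [||||b [bZ [bS bU _]]] := @iwahori_lift K qq _ psi
    (hS (iwahori qq')) (hU (iwahori qq')) (hV (iwahori qq')) psiC.
- exact: (hl_UV hyp).
- exact: (hl_VU hyp).
- exact: (hl_UUS hyp).
- by rewrite (hl_SS hyp) /= rmorphB rmorph1 phiq.
by exists b; split=> // k h; rewrite bZ /= mulr_algl.
Qed.

Section IwahoriComponent.
Variable F : finFieldType.
Local Notation K := {poly Zt F}.
Local Notation H := (hecke F).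
Local Notation H1 := (HZt F).
Let hyp := hecke_is_hecke_like F.
Let hyp1 := iwahori_hecke_like ('X : K).
Local Notation eA := (eps (triv_char F)).
Local Notation e := (val eA).

Lemma triv_is_char : is_char (triv_char F).
Proof. by split=> [|t u]; rewrite !ffunE ?mulr1. Qed.

Lemma triv_char_swap : char_swap (triv_char F) = triv_char F.
Proof. by apply/ffunP=> t; rewrite !ffunE. Qed.

Lemma triv_central : central e.
Proof.
apply: (invariant_central (hyp := hyp)).
by have [-> _] := aswap_eps (triv_char F); rewrite triv_char_swap.
Qed.

Lemma triv_idem : e * e = e.
Proof. by rewrite -avalM eps_idem //; apply: triv_is_char. Qed.

Lemma triv_hc : hc H * e = ('X - 1) *: e.
Proof.
rewrite -pro_p_aC_val -avalM (eps_pro_p_aC triv_is_char triv_char_swap).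
exact: avalZ.
Qed.

Lemma triv_hT t : @hT K H t * e = e.
Proof.
rewrite -triv_central; have := eps_T t triv_is_char.
by move/(congr1 val); rewrite ffunE scale1r.
Qed.

Lemma iwahori_component_ex : exists i : {linear H1 -> H}, is_iwahori_component i.
Proof.
have eC := triv_central.
have [f [ef fe ff fC e_f]] : exists f : H,
    [/\ e * f = 0, f * e = 0, f * f = f, forall h, f * h = h * f & 1 = e + f].
  have ef : e * (1 - e) = 0 by rewrite mulrBr mulr1 triv_idem subrr.
  exists (1 - e); split=> //; last by rewrite addrC subrK.
  - by rewrite mulrBl mul1r triv_idem subrr.
  - by rewrite {1}mulrBl mul1r ef subr0.
  - by move=> h; rewrite mulrBl mulrBr mul1r mulr1 eC.
have SM : hS H * hS H * e = 'X *: e + ('X - 1) *: (hS H * e).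
  rewrite (hl_SS hyp) mulrDl mulr_algl -mulrA -(eC (hS H)).
  by rewrite mulrA triv_hc -scalerAl.
(* The relations of [H_1] only hold on the component of [e]; on the complement
   [S] is replaced by the scalar [bold q]. *)
pose s : H := hS H * e + 'X *: f.
pose psi : {rmorphism K -> H} := in_alg H.
have psiC k (y : H) : psi k * y = y * psi k by rewrite /= mulr_algl mulr_algr.
have [||||j [jZ [jS jU jV]]] := @iwahori_lift K 'X _ psi s (hU H) (hV H) psiC.
- exact: hecke_UVE.
- exact: hecke_VUE.
- by rewrite -expr2; apply: (hz_central hyp).
- have a1 : hS H * e * (hS H * e) = hS H * hS H * e.
    by rewrite mulrA -(mulrA _ e) eC mulrA -mulrA triv_idem.
  have a2 : hS H * e * ('X *: f) = 0 by rewrite -scalerAr -mulrA ef mulr0 scaler0.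
  have a3 : 'X *: f * (hS H * e) = 0.
    by rewrite -scalerAl mulrA fC -mulrA fe mulr0 scaler0.
  have a4 : 'X *: f * ('X *: f) = 'X *: ('X *: f) by rewrite -scalerAl -scalerAr ff.
  rewrite /= mulr_algl /s mulrDl !mulrDr a1 a2 a3 a4 addr0 add0r SM.
  rewrite e_f !scalerDr -[LHS]addrA -[RHS]addrA.
  congr (_ + _); rewrite [RHS]addrCA; congr (_ + _).
  by rewrite [in RHS]scalerBl scale1r addrCA subrr addr0.
pose i h := j h * e.
have iB : zmod_morphism i by move=> x y; rewrite /i rmorphB mulrBl.
have iZ : scalable i by move=> k x; rewrite /i jZ mulr_algl scalerAl.
pose fa := GRing.isZmodMorphism.Build _ _ i iB.
pose fs := GRing.isScalable.Build _ _ _ _ i iZ.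
have iM h h' : i (h * h') = i h * i h'.
  by rewrite /i rmorphM /= -[RHS]mulrA eC -(mulrA (j h')) triv_idem mulrA.
have i1 : i 1 = e by rewrite /i rmorph1 mul1r.
have iS : i (hS H1) = hS H * e.
  by rewrite /i jS /s mulrDl -mulrA triv_idem -scalerAl fe scaler0 addr0.
have iU : i (hU H1) = hU H * e by rewrite /i jU.
have iV : i (hV H1) = hV H * e by rewrite /i jV.
exists (HB.pack i fa fs : {linear H1 -> H}); split=> //.
pose psi1 : {rmorphism K -> H1} := in_alg H1.
have psi1C k (y : H1) : psi1 k * y = y * psi1 k by rewrite /= mulr_algl mulr_algr.
(* The inverse on the component comes from the quotient T_t -> 1, which sends c_s to [cs_coef] times
   q - 1, that is 'X - 1: the quadratic relation of [H1]. *)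
have [||||||||r [rZ [rT rS rU rV]]] := @hecke_lift F _ psi1 (fun=> 1)
   (hS H1) (hU H1) (hV H1) psi1C.
- by move=> *; rewrite mulr1.
- by [].
- by move=> *; rewrite mulr1 mul1r.
- by move=> *; rewrite mulr1 mul1r.
- exact: (hl_UV hyp1).
- exact: (hl_VU hyp1).
- exact: (hl_UUS hyp1).
- rewrite (hl_SS hyp1) sumr_const -cardsT card_finField_unit.
  congr (_ + _ * _); rewrite -[hc H1]/(('X - 1) *: 1) -cs_coef_qm1 /= mulr_algl.
  by rewrite -[LHS]scalerA scaler_nat.
have re : r e = 1.
  rewrite /eps avalZ raddf_sum rZ rmorph_sum /=.
  under eq_bigr do rewrite rZ rT mulr1 ffunE rmorph1.
  rewrite sumr_const card_torus mulr_algl -scaler_nat scalerA -[RHS]scale1r.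
  rewrite -[X in _ = X *: _](inv_qm1_sqr F); congr (_ * _ *: _).
  by rewrite natrX rmorphXn rmorph_nat.
have ri : cancel i r.
  elim/iwahori_ind=> [k||||x y ex ey|x y ex ey].
  - by rewrite iZ i1 rZ re mulr1.
  - by rewrite iS rmorphM re mulr1 rS.
  - by rewrite iU rmorphM re mulr1 rU.
  - by rewrite iV rmorphM re mulr1 rV.
  - by rewrite /i rmorphD mulrDl rmorphD -/(i x) -/(i y) /= ex ey.
  - by rewrite iM rmorphM /= ex ey.
split; first exact: (can_inj ri).
suff ir h : i (r h) = h * e by move=> h he; exists (r h); rewrite /= ir.
elim/hecke_ind: h => [k|t||||x y ex ey|x y ex ey].
- by rewrite rZ rmorph1 mulr1 [psi1 k]/= iZ i1 -scalerAl mul1r.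
- by rewrite rT i1 triv_hT.
- by rewrite rS iS.
- by rewrite rU iU.
- by rewrite rV iV.
- by rewrite rmorphD /i rmorphD mulrDl -/(i (r x)) -/(i (r y)) ex ey mulrDl.
- by rewrite rmorphM iM ex ey -[LHS]mulrA eC -(mulrA y) triv_idem mulrA.
Qed.

End IwahoriComponent.

(** The trivial character is fixed by the swap, so [pro_p_u0] is X on its component for every [ord],
    as in [iwahori_rep]. Both compatibilities are then cases of [beta_hrep], with e the trivial
    idempotent and with e = 1. *)
Lemma pro_p_iwahori_spherical (F : finFieldType) (ord : pred {ffun torus F -> Zt F}) :
  iwahori_component_spherical (pro_p_rep ord).
Proof.
pose phi : {rmorphism {poly int} -> {poly Zt F}} := map_poly intr.
have [b bP] := @iwahori_base_change _ _ 'X 'X phi (map_polyX _).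
have [i iP] := iwahori_component_ex F.
pose cv : commr_rmorph (intr : int -> Zhalf) (vpow 2) := fun a => mulrC _ _.
pose phi' : {rmorphism {poly int} -> Zhalf} := horner_morph cv.
have [b' b'P] := @iwahori_base_change _ _ 'X (vpow 2) phi' (horner_morphX cv).
have [theta [thetaV [thetaK thetaVK thetaE]]] := bernstein_iso.
exists b, i, (@iwahori_rep _ 'X), b', (@iwahori_rep _ (vpow 2)), theta.
exists (spherical_rep theta thetaV).
split.
- split; [exact: bP | exact: iP |].
  split; [exact: iwahori_rep_hecke_rep | exact: iwahori_rep_extends_mul |].
  exact: iwahori_rep_demazure.
- have [bZ bS bU] := bP; have [iM i1 iS iU _] := iP.
  pose beta (h : HZ) : hecke F := i (b h).
  have betac : beta (hc HZ) = hc (hecke F) * val (eps (triv_char F)).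
    rewrite /beta -[hc HZ]/(('X - 1) *: 1) bZ linearZ rmorph1 i1 triv_hc.
    by rewrite rmorphB rmorph1 /= map_polyX.
  apply: (@beta_hrep _ _ _ _ _ _ _ _ _ _ _ _ _ _ _ _ _ _ _ _ phi beta
    (eps (triv_char F))) => //.
  + by move=> x y; rewrite /beta !raddfD.
  + by move=> x y; rewrite /beta rmorphM iM.
  + by move=> k x; rewrite /beta bZ linearZ.
  + by rewrite /beta rmorph1 i1.
  + by rewrite /beta bS iS.
  + by rewrite /beta bU iU.
  + exact: triv_central.
  + by rewrite (eps_pro_p_u0 _ (triv_is_char F)) /u0_at triv_char_swap eqxx.
- by split; [exact: b'P | apply: iwahori_rep_hecke_rep].
- have [bZ bS bU] := b'P.
  apply: (@beta_hrep _ _ _ _ _ _ _ _ _ _ _ _ _ _ _ _ _ _ _ _ phi' b' 1) => //.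
  + exact: rmorphD.
  + exact: rmorphM.
  + by rewrite rmorph1 aval1.
  + by rewrite bS aval1 mulr1.
  + by rewrite bU aval1 mulr1.
  + rewrite -[hc HZ]/(('X - 1) *: 1) bZ rmorph1 aval1 mulr1 rmorphB rmorph1.
    by rewrite [phi' 'X]horner_morphX.
  + by rewrite aval1 mulr1 mul1r.
- split; last exact: spherical_uniq.
  + by apply: bern_bernstein => //; exists thetaV.
  + by move=> h f; rewrite /spherical_rep thetaVK.
  + exact: sph_classical.
Qed.

Theorem theoremA (F : finFieldType) (ord : pred {ffun torus F -> Zt F})
    (ord_order : orbit_order ord) :
  exists rho : hecke F -> Asub (hecke F) -> Asub (hecke F),
    [/\ hecke_rep rho /\ faithful_rep rho,
        extends_mul rho,
        demazure_vigneras ord (rho (hS (hecke F))),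
        forall rho' : hecke F -> Asub (hecke F) -> Asub (hecke F),
          hecke_rep rho' -> extends_mul rho' ->
          demazure_vigneras ord (rho' (hS (hecke F))) ->
          forall h, rho' h =1 rho h
      & iwahori_component_spherical rho].
Proof.
exists (pro_p_rep ord); split.
- split; last exact: pro_p_faithful.
  by apply: hrep_rep; [apply: pro_p_u0P | apply: pro_p_faithful].
- exact: hrep_extends_mul.
- exact: pro_p_demazure_vigneras.
- exact: pro_p_uniq.
- exact: pro_p_iwahori_spherical.
Qed.
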